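(* Assume that $\mathcal P$ is locally compact and that $X$ is a quasi-Banach function lattice over $(\mathcal P,\mu)$ with the Vitali--Carathéodory property. (In particular, instead of the Vitali--Carathéodory property we may assume that $X$ contains characteristic functions of all bounded sets and that these have absolutely continuous quasi-norm in $X$.) If continuous functions are dense in $N^1X$ (i.e. $C(\mathcal P)\cap N^1X$ is dense in $N^1X$), then every $u\in N^1X$ is quasi-continuous.
   Context: Setting. $\mathcal P=(\mathcal P,\mathrm d,\mu)$ is a metric space with a $\sigma$-finite Borel regular measure $\mu$ (all Borel sets are $\mu$-measurable, and every $\mu$-measurable set $A$ is contained in a Borel set $D$ with $\mu(D)=\mu(A)$) such that every ball has finite positive measure. $\mathcal M(\mathcal P,\mu)$ is the set of all extended real-valued $\mu$-measurable functions on $\mathcal P$ (defined everywhere). Quasi-Banach function lattice: a linear space $X=\{u\in\mathcal M(\mathcal P,\mu):\|u\|_X<\infty\}$ given by a functional $\|\cdot\|_X:\mathcal M(\mathcal P,\mu)\to[0,\infty]$ such that: $\|u\|_X=0$ iff $u=0$ a.e.; $\|au\|_X=|a|\,\|u\|_X$ for $a\in\mathbb R$; there is a constant $c_\triangle\ge1$ (modulus of concavity) with $\|u+v\|_X\le c_\triangle(\|u\|_X+\|v\|_X)$; if $|u|\le|v|$ a.e. then $\|u\|_X\le\|v\|_X$; and (Riesz--Fischer) if $u_n\ge0$ a.e. for all $n$ then $\|\sum_{n=1}^\infty u_n\|_X\le\sum_{n=1}^\infty c_\triangle^n\|u_n\|_X$. The quasi-norm is also assumed continuous: $\|u_n-u\|_X\to0$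 implies $\|u_n\|_X\to\|u\|_X$. Vitali--Carathéodory property: $\|u\|_X=\inf\{\|v\|_X: v\ge|u|\text{ on }\mathcal P,\ v\text{ lower semicontinuous on }\mathcal P\}$ for every measurable $u:\mathcal P\to[-\infty,\infty]$. A function $u\in X$ has absolutely continuous quasi-norm in $X$ if $\|u\chi_{E_n}\|_X\to0$ whenever $\{E_n\}$ is a decreasing sequence of measurable sets with $\mu(\bigcap_nE_n)=0$. Newtonian space. A curve is a non-constant continuous map $\gamma$ from a compact interval into $\mathcal P$ of finite length, parametrized by arc length $ds$ on $[0,l_\gamma]$. A Borel function $g:\mathcal P\to[0,\infty]$ is an upper gradient of $u:\mathcal P\to[-\infty,\infty]$ if $|u(\gamma(0))-u(\gamma(l_\gamma))|\le\int_\gamma g\,ds$ for every curve $\gamma$, with the convention $|(\pm\infty)-(\pm\infty)|=\infty$. Set $\|u\|_{N^1X}=\|u\|_X+\inf_g\|g\|_X$, infimum over all upper gradients $g$ of $u$, and $N^1X=\{u\in\mathcal M(\mathcal P,\mu):\|u\|_{N^1X}<\infty\}$ (a quasi-seminormed space of everywhere defined functions). Capacity. $C_X(E)=\inf\{\|u\|_{N^1X}:u\ge1\text{ on }E\}$ for $E\subset\mathcal P$. A function $u:\mathcal P\to[-\infty,\infty]$ is quasi-continuous if for every $\varepsilon>0$ there is an open set $E\subset\mathcal P$ with $C_X(E)<\varepsilon$ such that $u|_{\mathcal P\setminus E}$ is continuous (and real-valued). *)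

(* Defs.v *)
From HB Require Import structures.
From mathcomp Require Import all_boot all_order all_algebra.
From mathcomp Require Import all_classical all_reals all_analysis.
From mathcomp Require Import measurable_realfun.

Set Implicit Arguments.
Unset Strict Implicit.
Unset Printing Implicit Defensive.

Import Order.TTheory GRing.Theory Num.Theory.
Import numFieldNormedType.Exports.

Local Open Scope classical_set_scope.
Local Open Scope ring_scope.

(* A metric space carrying a sigma-algebra [measurable], which plays the role
   of the mu-measurable sets. No relation between the metric and the
   sigma-algebra is built in; see [metric_measure_space]. *)
#[short(type="metricMeasurableType")]
HB.structure Definition MetricMeasurable (d : measure_display)
  (R : numDomainType) := {T of Metric R T & Measurable d T}.

Section Newtonian.
Context {R : realType} {d : measure_display} {P : metricMeasurableType d R}.
Implicit Types (mu : {measure set P -> \bar R}) (u v g : P -> \bar R).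
Local Open Scope ereal_scope.

Definition borel_set (A : set P) : Prop := <<s (@open P) >> A.

Definition borel_fun g : Prop :=
  measurable_fun setT (g : g_sigma_algebraType (@open P) -> \bar R).

Definition bounded_subset (A : set P) : Prop :=
  exists (x : P) (r : R), A `<=` ball x r.

Record metric_measure_space mu : Prop := {
  mms_sigma_finite : sigma_finite [set: P] mu ;
  mms_borel : forall A : set P, borel_set A -> measurable A ;
  mms_borel_regular : forall A : set P, measurable A ->
    exists D : set P, [/\ borel_set D, A `<=` D & mu D = mu A] ;
  mms_ball : forall (x : P) (r : R), (0 < r)%R ->
    0 < mu (ball x r) /\ mu (ball x r) < +oo
}.

(* [N] is the functional ||.||_X; only its values at measurable functions are
   constrained, and only those are used below. In the library
   +oo - (+oo) = -oo: this convention never matters in [qbfl_triangle], since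
   functions of finite quasi-norm are finite a.e. and [N] only depends on
   a.e. equivalence classes. In [qbfl_continuous] it makes |u_n - u| = +oo where
   u_n and u take the same infinite value. *)
Record quasi_banach_function_lattice mu (c : R)
    (N : (P -> \bar R) -> \bar R) : Prop := {
  qbfl_ge0 : forall u, measurable_fun setT u -> 0 <= N u ;
  qbfl_eq0 : forall u, measurable_fun setT u ->
    (N u = 0 <-> {ae mu, forall x, u x = 0}) ;
  qbfl_homogeneous : forall (a : R) u, measurable_fun setT u ->
    N (fun x => a%:E * u x) = `|a|%:E * N u ;
  qbfl_modulus_ge1 : (1 <= c)%R ;
  qbfl_triangle : forall u v,
    measurable_fun setT u -> measurable_fun setT v ->
    N (u \+ v) <= c%:E * (N u + N v) ;
  qbfl_lattice : forall u v,
    measurable_fun setT u -> measurable_fun setT v ->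
    {ae mu, forall x, `|u x| <= `|v x|} -> N u <= N v ;
  qbfl_riesz_fischer : forall u_ : nat -> P -> \bar R,
    (forall n, measurable_fun setT (u_ n)) ->
    (forall n, {ae mu, forall x, 0 <= u_ n x}) ->
    N (fun x => \sum_(1 <= n <oo) u_ n x) <=
      \sum_(1 <= n <oo) (c ^+ n)%:E * N (u_ n) ;
  qbfl_continuous : forall (u_ : nat -> P -> \bar R) u,
    (forall n, measurable_fun setT (u_ n)) -> measurable_fun setT u ->
    N (u_ n \- u) @[n --> \oo] --> 0 -> N (u_ n) @[n --> \oo] --> N u
}.

Variable N : (P -> \bar R) -> \bar R.

Definition in_X u : Prop := measurable_fun setT u /\ N u < +oo.

Definition vitali_caratheodory : Prop :=
  forall u, measurable_fun setT u ->
    N u = ereal_inf [set N v | v in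
      [set v | (forall x, `|u x| <= v x) /\ lower_semicontinuous v]].

Definition absolutely_continuous_norm mu u : Prop :=
  forall E : nat -> set P,
    (forall n, measurable (E n)) -> (forall n, E n.+1 `<=` E n) ->
    mu (\bigcap_n E n) = 0 ->
    N (fun x => u x * (\1_(E n) x)%:E) @[n --> \oo] --> 0.

Definition bounded_sets_absolutely_continuous mu : Prop :=
  forall A : set P, measurable A -> bounded_subset A ->
    in_X (fun x => (\1_A x)%:E) /\
    absolutely_continuous_norm mu (fun x => (\1_A x)%:E).

Definition curve_length (a b : R) (gamma : R -> P) : \bar R :=
  ereal_sup [set
    (let F := gamma \o nth b (a :: s) in
     \sum_(0 <= n < size s) mdist (F n) (F n.+1))%R%:E
    | s in itv_partition a b].

(* The values of [gamma] outside [0, l] are irrelevant. The last condition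
   says that [gamma] is parametrized by arc length; it entails that the
   length of [gamma] is [l], in particular finite. *)
Record is_curve (l : R) (gamma : R -> P) : Prop := {
  curve_ge0 : (0 <= l)%R ;
  curve_continuous : {within `[0%R, l], continuous gamma} ;
  curve_nonconstant : exists s t : R,
    [/\ s \in `[0%R, l], t \in `[0%R, l] & gamma s <> gamma t] ;
  curve_arclength : forall s t : R, (0 <= s)%R -> (s <= t)%R -> (t <= l)%R ->
    curve_length s t gamma = (t - s)%:E
}.

(* In the library (+oo) - (+oo) and (-oo) - (-oo) are -oo, so `|u x - u y| is
   +oo when u x and u y are equal and infinite, as required. *)
Definition upper_gradient u g : Prop :=
  [/\ borel_fun g, forall x, 0 <= g x &
    forall (l : R) (gamma : R -> P), is_curve l gamma ->
      `|u (gamma 0%R) - u (gamma l)| <=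
        \int[lebesgue_measure]_(t in `[0%R, l]) g (gamma t)].

Definition N1norm u : \bar R :=
  N u + ereal_inf [set N g | g in upper_gradient u].

Definition in_N1X u : Prop := measurable_fun setT u /\ N1norm u < +oo.

Definition continuous_dense_N1X : Prop :=
  forall u, in_N1X u -> forall eps : R, (0 < eps)%R ->
    exists f : P -> R, [/\ continuous f, in_N1X (EFin \o f) &
      N1norm (u \- (EFin \o f)) < eps%:E].

Definition capacity (E : set P) : \bar R :=
  ereal_inf [set N1norm u | u in
    [set u | measurable_fun setT u /\ forall x, E x -> 1 <= u x]].

Definition quasi_continuous u : Prop :=
  forall eps : R, (0 < eps)%R ->
    exists E : set P, [/\ open E, capacity E < eps%:E,
      {within ~` E, continuous u} & forall x, ~ E x -> u x \is a fin_num].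

End Newtonian.

(* Main.v *)
Require Import Defs.
From HB Require Import structures.
From mathcomp Require Import all_boot all_order all_algebra.
From mathcomp Require Import all_classical all_reals all_analysis.
From mathcomp Require Import measurable_realfun.
From mathcomp Require Import ring lra.

Set Implicit Arguments.
Unset Strict Implicit.
Unset Printing Implicit Defensive.

Import Order.TTheory GRing.Theory Num.Theory.
Import numFieldNormedType.Exports.

Local Open Scope classical_set_scope.
Local Open Scope ring_scope.

(* Continuous functions f_k converge to u so fast in N^1X that, by the weak type
   estimate, the open sets {|f_k - f_(k+1)| > 2^-k} have a union of small capacity,
   outside which (f_k) is uniformly Cauchy; its limit is u outside a set Z such
   that C_X(Z) = 0. It remains to enclose Z in an open set of small capacity.
   Countable subadditivity reduces this to a subset E of a small ball with compact
   closure. If h, equal to 1 on E, has an upper gradient g with N h and N g small,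
   then h and g have lower semicontinuous majorants w and v of small quasi-norm,
   and the capacity of {p > 1/2} is small, where p(x) is the minimum of 1 and of
   the integrals of a combination of v and w along the curves joining x to the
   complement of the part of {w > 1/2} in a larger ball. This function is lower
   semicontinuous by Arzela-Ascoli and Fatou, and it is 1 on E. *)

(** * Integrals along Lipschitz maps of the line *)

(** The obstacle is [Z]: functions of [N^1X] are defined everywhere, so [Z] cannot be discarded, and
    vanishing capacity alone provides no open set around it. The superlevel sets of [h] need not be
    open, while a lower semicontinuous majorant of [h] is controlled in [X] only and comes with no
    upper gradient. The infimum of path integrals restores both properties at once: its integrand is
    an upper gradient by construction, and semicontinuity of the integrand passes to the infimum as
    soon as nearly optimal paths form a compact family. Two devices ensure this. Paths are stopped
    when they leave a set with compact closure, which is where local compactness enters; and the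
    term containing [w] bounds the integrand from below until then, so that a bound on the cost is a
    bound on the length. The price is a factor depending on the radius of the ball, affordable
    because it multiplies a capacity that is arbitrarily small. Countably many balls suffice without
    any assumption of separability, because balls have finite positive measure. *)

Lemma le_lipschitz_image_measure (R : realType) (s : R -> R) (A B : set R) :
  (forall x y, `|s x - s y| <= `|x - y|) ->
  measurable A -> measurable B -> B `<=` s @` A ->
  (lebesgue_measure B <= lebesgue_measure A)%E.
Proof.
move=> s1 mA mB BsA; rewrite [leRHS]/lebesgue_measure/=.
rewrite /lebesgue_stieltjes_measure/= /measure_extension/= /mu_ext.
(* [F] is a cover of [A] by half-open intervals, as in the definition of outer measure; it is
   carried to a cover [G] of the image of [A], hence of [B], of no greater total measure. *)
apply: le_ereal_inf_tmp => _ [F [mF AF] <-].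
have /choice[G GP] : forall k, exists G : set R,
    [/\ measurable G, s @` (F k) `<=` G &
      (lebesgue_measure G <= wlength idfun (F k))%E].
  move=> k; have /ocitvP[->|[[p q] /= pq ->]] := mF k.
    by exists set0; rewrite image_set0 measure0 wlength0; split.
  (* a 1-Lipschitz map sends an interval to one of the same length, centred at
     the image of the midpoint *)
  exists `[s ((p + q) / 2) - (q - p) / 2, s ((p + q) / 2) + (q - p) / 2]%classic.
  split; first exact: measurable_itv.
    move=> _ [x /= xpq <-]; move: xpq; rewrite !in_itv/= => /andP[px xq].
    have := s1 x ((p + q) / 2).
    have : `|x - (p + q) / 2| <= (q - p) / 2 by rewrite ler_norml; lra.
    by move=> /[swap] /le_trans/[apply]; rewrite ler_norml => /andP[? ?]; lra.
  rewrite lebesgue_measure_itv/= wlength_itv/= !lte_fin pq.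
  by case: ifPn => _; rewrite -!EFinD lee_fin; lra.
apply: (@le_trans _ _ (\sum_(k <oo) lebesgue_measure (G k))%E).
  apply: measure_sigma_subadditive => //; first by move=> k; have [] := GP k.
  move=> _ /BsA[x Ax <-]; have [k _ Fkx] := AF _ Ax.
  by exists k => //; have [_ + _] := GP k; apply; exists x.
by apply: lee_nneseries => k _ //; have [] := GP k.
Qed.

(** Lebesgue measure on [B] is at most the image under [s] of Lebesgue measure on [A], and [f] is
    integrated against both. This inequality serves as change of variables for reparametrizations,
    translations and reflections. *)
Lemma le_integral_lipschitz (R : realType) (s : R -> R) (A B : set R)
    (f : R -> \bar R) :
  (forall x y, `|s x - s y| <= `|x - y|) ->
  measurable A -> measurable B -> B `<=` s @` A ->
  measurable_fun setT f -> (forall x, (0 <= f x)%E) ->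
  (\int[lebesgue_measure]_(y in B) f y <=
   \int[lebesgue_measure]_(x in A) f (s x))%E.
Proof.
move=> s1 mA mB BsA mf f0.
have cs : continuous s.
  move=> x; apply/cvgrPdist_le => e e0; near=> y.
  apply: le_trans (s1 _ _) _; near: y.
  exact: (@cvgr_dist_le _ _ _ _ _ idfun x).
have ms : measurable_fun setT (s : measurableTypeR R -> measurableTypeR R).
  exact: continuous_measurable_fun.
have mfs : measurable_fun setT (f \o s).
  by apply: (measurableT_comp mf).
pose nu : {measure set (measurableTypeR R) -> \bar R} :=
  mrestr (@lebesgue_measure R) mA.
pose m1 : {measure set (measurableTypeR R) -> \bar R} :=
  mrestr (@lebesgue_measure R) mB.
rewrite (@eq_measure_integral _ _ _ _ m1); last first.
  by move=> S mS SB; rewrite /m1/= /mrestr setIidl.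
have msB : measurable (s @^-1` B) by rewrite -[X in measurable X]setTI; exact: ms.
apply: (@le_trans _ _ (\int[nu]_(x in s @^-1` B) (f \o s) x)%E).
  rewrite -(ge0_integral_pushforward ms nu mB); last 2 first.
    exact: measurable_funTS.
    by move=> *.
  apply: ge0_le_measure_integral => // S mS.
  rewrite /m1 /nu/= /mrestr/= /pushforward /mrestr.
  apply: (le_lipschitz_image_measure s1).
  - apply: measurableI => //; rewrite -[X in measurable X]setTI; exact: ms.
  - exact: measurableI.
  - by move=> y [Sy /BsA[x Ax sxy]]; exists x => //; split => //=; rewrite sxy.
rewrite -(setUIDK (s @^-1` B) A) ge0_integral_setU//=; last 4 first.
- exact: measurableI.
- exact: measurableD.
- exact: measurable_funTS.
- by rewrite disj_set2E; apply/eqP/seteqP; split => // x [[_ ?] []].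
rewrite [X in (_ + X)%E](@null_set_integral _ _ _ nu); last 3 first.
- exact: measurableD.
- exact: measurable_funTS.
- by rewrite /nu/= /mrestr setDE -setIA setICl setI0 measure0.
rewrite adde0 (@eq_measure_integral _ _ _ _ (@lebesgue_measure R)); last first.
  by move=> S mS SB; rewrite /nu/= /mrestr setIidl// => x /SB[].
apply: ge0_subset_integral => //; first exact: measurableI.
exact: measurable_funTS.
Unshelve. all: end_near. Qed.

(** * Arc length *)

Section Curves.
Context {R : realType} {d : measure_display} {P : metricMeasurableType d R}.
Implicit Types (gamma : R -> P) (a b t l : R).

(* Curves are handled as 1-Lipschitz maps on the whole real line: contrary to
   arc length parametrizations, these are stable under pointwise limits. *)
Definition lip1 gamma := forall s t, mdist (gamma s) (gamma t) <= `|s - t|.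

Fixpoint polygonal_length gamma (a : R) (s : seq R) : R :=
  if s is y :: s' then mdist (gamma a) (gamma y) + polygonal_length gamma y s'
  else 0.

Lemma curve_lengthE a b gamma : curve_length a b gamma =
  ereal_sup [set (polygonal_length gamma a s)%:E | s in itv_partition a b].
Proof.
rewrite /curve_length; congr ereal_sup.
apply/seteqP; split=> _ [s sab <-]; exists s => //; congr EFin;
  elim: s a {sab} => [|y s ih] a /=; [by rewrite big_geq| |by rewrite big_geq|];
  by rewrite big_nat_recl//=; congr (_ + _); rewrite -ih.
Qed.

Lemma polygonal_length_cat gamma a (s t : seq R) :
  polygonal_length gamma a (s ++ t) =
  polygonal_length gamma a s + polygonal_length gamma (last a s) t.
Proof. by elim: s a => [|y s ih] a /=; rewrite ?add0r// ih addrA. Qed.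

Lemma polygonal_length_le gamma (F : R -> R) a b s :
  (forall x y, a <= x -> x <= y -> y <= b ->
     mdist (gamma x) (gamma y) <= F y - F x) ->
  itv_partition a b s -> polygonal_length gamma a s <= F b - F a.
Proof.
elim: s a => [|y s ih] a dF pab /=.
  by rewrite (itv_partition_nil pab) subrr.
have pyb := itv_partition_cons pab.
have ay : a < y by move: pab => [/= /andP[]].
have yb := itv_partition_le pyb.
have := ih y (fun x z xy => dF x z (le_trans (ltW ay) xy)) pyb.
have := dF a y (lexx _) (ltW ay) yb; lra.
Qed.

(* The length is the least increase of a function whose increments dominate
   distances: this characterizes it without partitions. *)
Lemma curve_length_le gamma (F : R -> R) a b :
  (forall x y, a <= x -> x <= y -> y <= b ->
     mdist (gamma x) (gamma y) <= F y - F x) ->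
  (curve_length a b gamma <= (F b - F a)%:E)%E.
Proof.
move=> dF; rewrite curve_lengthE; apply: ge_ereal_sup => _ [s ps <-].
by rewrite lee_fin; exact: polygonal_length_le.
Qed.

Lemma mdist_le_curve_length gamma a b : a <= b ->
  ((mdist (gamma a) (gamma b))%:E <= curve_length a b gamma)%E.
Proof.
rewrite le_eqVlt curve_lengthE => /orP[/eqP<-|ab]; apply: ereal_sup_ubound.
  by exists [::] => //=; rewrite mdistxx.
by exists [:: b]; [exact: itv_partition1|rewrite /= addr0].
Qed.

Lemma curve_length_superadditive gamma a b c (M : R) :
  a <= b -> b <= c -> curve_length b c gamma \is a fin_num ->
  (curve_length a c gamma <= M%:E)%E ->
  (curve_length a b gamma + curve_length b c gamma <= M%:E)%E.
Proof.
move=> ab bc bcfin acM; rewrite -leeBrDr//.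
rewrite [leLHS]curve_lengthE; apply: ge_ereal_sup => _ [s ps <-].
rewrite leeBrDr// addeC -leeBrDr//.
rewrite [leLHS]curve_lengthE; apply: ge_ereal_sup => _ [t pt <-].
rewrite leeBrDr// -EFinD; apply: le_trans acM.
rewrite curve_lengthE; apply: ereal_sup_ubound; exists (s ++ t).
  exact: itv_partition_cat ps pt.
by rewrite polygonal_length_cat; case: ps => _ /eqP ->; rewrite addrC.
Qed.

Definition arclength gamma a b : R := fine (curve_length a b gamma).

Section lip1.
Variables (gamma : R -> P) (gamma1 : lip1 gamma).

Lemma lip1_mdist x y : x <= y -> mdist (gamma x) (gamma y) <= y - x.
Proof. by move=> xy; rewrite (le_trans (gamma1 _ _))// distrC ger0_norm// subr_ge0. Qed.

Lemma curve_length_fin a b : a <= b ->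
  curve_length a b gamma = (arclength gamma a b)%:E.
Proof.
move=> ab; rewrite /arclength fineK// ge0_fin_numE.
  apply: (@le_lt_trans _ _ (b - a)%:E); last exact: ltry.
  by apply: (@curve_length_le _ idfun) => x y _ xy _; exact: lip1_mdist.
apply: le_trans (mdist_le_curve_length _ ab).
by rewrite lee_fin mdist_ge0.
Qed.

Lemma arclength_le (F : R -> R) a b : a <= b ->
  (forall x y, a <= x -> x <= y -> y <= b ->
     mdist (gamma x) (gamma y) <= F y - F x) ->
  arclength gamma a b <= F b - F a.
Proof. by move=> ab dF; rewrite -lee_fin -curve_length_fin//; exact: curve_length_le. Qed.

Lemma mdist_le_arclength a b : a <= b ->
  mdist (gamma a) (gamma b) <= arclength gamma a b.
Proof.
by move=> ab; rewrite -lee_fin -curve_length_fin//; exact: mdist_le_curve_length.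
Qed.

Lemma arclength_ge0 a b : a <= b -> 0 <= arclength gamma a b.
Proof. by move=> ab; exact: le_trans (mdist_ge0 _ _) (mdist_le_arclength ab). Qed.

Lemma arclength_le_sub a b : a <= b -> arclength gamma a b <= b - a.
Proof. by move=> ab; apply: (@arclength_le idfun) => // x y _ xy _; exact: lip1_mdist. Qed.

Lemma arclengthD a b c : a <= b -> b <= c ->
  arclength gamma a b + arclength gamma b c = arclength gamma a c.
Proof.
move=> ab bc; have ac := le_trans ab bc.
have super x y z : x <= y -> y <= z ->
    arclength gamma x y + arclength gamma y z <= arclength gamma x z.
  move=> xy yz; rewrite -lee_fin EFinD -(curve_length_fin xy) -(curve_length_fin yz).
  apply: curve_length_superadditive => //; first by rewrite curve_length_fin.
  by rewrite curve_length_fin// (le_trans xy).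
apply/eqP; rewrite eq_le super//=.
(* [F] is the length accumulated from [a], with a break at [b]. Its increments dominate distances,
   which gives the missing inequality without inserting [b] into partitions. *)
pose F x := if x <= b then arclength gamma a x
            else arclength gamma a b + arclength gamma b x.
have Fa : F a = 0.
  rewrite /F ab; apply/eqP; rewrite eq_le arclength_ge0// andbT.
  by have := arclength_le_sub (lexx a); rewrite subrr.
have Fc : F c = arclength gamma a b + arclength gamma b c.
  rewrite /F; case: ifPn => // cb; have -> : c = b by apply/eqP; rewrite eq_le cb.
  suff -> : arclength gamma b b = 0 by rewrite addr0.
  apply/eqP; rewrite eq_le arclength_ge0// andbT.
  by have := arclength_le_sub (lexx b); rewrite subrr.
rewrite -Fc -[leRHS]subr0 -Fa; apply: arclength_le => // x y ax xy yc.
rewrite /F; case: (leP y b) => yb.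
  rewrite (le_trans xy yb); have := super _ _ _ ax xy.
  by have := mdist_le_arclength xy; lra.
case: (leP x b) => xb.
  have := super _ _ _ ax xb; have := mdist_le_arclength xb.
  have := mdist_le_arclength (ltW yb).
  have := metric_triangle (gamma x) (gamma b) (gamma y); lra.
have := super _ _ _ (ltW xb) xy; have := mdist_le_arclength xy; lra.
Qed.

End lip1.

(** Composition with this retraction of the line onto [0, l] extends a map given on [0, l] to the
    whole line without increasing its Lipschitz constant. *)
Definition clamp l t : R := Num.max 0 (Num.min t l).

Lemma clamp_itv l t : 0 <= l -> 0 <= clamp l t <= l.
Proof. by move=> l0; rewrite /clamp le_max lexx /= ge_max l0 ge_min lexx orbT. Qed.

Lemma clamp_id l t : 0 <= t <= l -> clamp l t = t.
Proof. by move=> /andP[t0 tl]; rewrite /clamp (min_idPl tl) (max_idPr t0). Qed.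

Lemma clamp_mono l s t : s <= t -> clamp l s <= clamp l t.
Proof.
move=> st; rewrite /clamp; case: (leP s l); case: (leP t l); case: (leP 0 s);
  case: (leP 0 t); case: (leP 0 l); lra.
Qed.

Lemma clamp_lip l s t : `|clamp l s - clamp l t| <= `|s - t|.
Proof.
wlog st : s t / s <= t.
  by move=> h; case/orP: (le_total s t) => /h//; rewrite distrC (distrC t).
rewrite distrC ger0_norm ?subr_ge0 ?clamp_mono// distrC ger0_norm ?subr_ge0//.
rewrite /clamp /Num.max /Num.min; do ![case: ifPn => //]; rewrite -?leNgt; lra.
Qed.

Section reparametrization.
Variables (gamma : R -> P) (gamma1 : lip1 gamma) (l : R) (l0 : 0 <= l).

Let s t := arclength gamma 0 (clamp l t).
Let L := arclength gamma 0 l.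

Lemma arclength_param_sub x y : 0 <= x -> x <= y -> y <= l ->
  s y - s x = arclength gamma x y.
Proof.
move=> x0 xy yl; rewrite /s !clamp_id ?x0 ?(le_trans x0 xy)//=; last exact: le_trans xy yl.
by rewrite -(arclengthD gamma1 x0 xy) addrC addKr.
Qed.

Lemma arclength_param_lip x y : `|s x - s y| <= `|x - y|.
Proof.
apply: le_trans (clamp_lip l x y).
have sE z : s z = s (clamp l z).
  by rewrite /s; congr arclength; rewrite [RHS]clamp_id// clamp_itv.
rewrite (sE x) (sE y).
move: (clamp l x) (clamp l y) (clamp_itv x l0) (clamp_itv y l0) => {sE}x' {}y.
move: x' => {}x.
wlog xy : x y / x <= y.
  move=> h hx hy; case/orP: (le_total x y) => xy; first exact: h.
  by rewrite distrC (distrC x); exact: h.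
move=> /andP[x0 xl] /andP[y0 yl].
rewrite distrC arclength_param_sub// distrC ger0_norm ?arclength_ge0//.
by rewrite ger0_norm ?subr_ge0// arclength_le_sub.
Qed.

Lemma mdist_arclength_param x y : 0 <= x <= l -> 0 <= y <= l ->
  mdist (gamma x) (gamma y) <= `|s x - s y|.
Proof.
wlog xy : x y / x <= y.
  move=> h hx hy; case/orP: (le_total x y) => xy; first exact: h.
  by rewrite metric_sym distrC; exact: h.
move=> /andP[x0 xl] /andP[y0 yl].
rewrite distrC arclength_param_sub// ger0_norm ?arclength_ge0//.
exact: mdist_le_arclength.
Qed.

Lemma arclength_param0 : s 0 = 0.
Proof.
rewrite /s clamp_id ?lexx ?l0//; apply/eqP; rewrite eq_le arclength_ge0// andbT.
by have := arclength_le_sub gamma1 (lexx 0); rewrite subrr.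
Qed.

Lemma arclength_param_surj z : 0 <= z <= L -> exists t, 0 <= t <= l /\ s t = z.
Proof.
move=> /andP[z0 zL].
have cs : {within `[0, l], continuous s}.
  apply: continuous_subspaceT => x; apply/cvgrPdist_le => e e0; near=> y.
  apply: le_trans (arclength_param_lip _ _) _; near: y.
  exact: (@cvgr_dist_le _ _ _ _ _ idfun x).
have s0 : s 0 = 0.
  exact: arclength_param0.
have sl : s l = L by rewrite /s clamp_id ?lexx ?l0.
have [|t] := @IVT _ s 0 l z l0 cs; last by rewrite in_itv/=; exists t.
by rewrite s0 sl min_l ?max_r ?z0// arclength_ge0.
Unshelve. all: end_near. Qed.

(** Distances along [gamma] are at most differences of accumulated length [s], so [gamma] factors
    through [s]; composing it with a right inverse [tau] of [s] gives [eta]. Distinct end points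
    make [eta] nonconstant, as [is_curve] demands. *)
Lemma arclength_reparam : gamma 0 <> gamma l ->
  exists (L : R) (eta : R -> P) (sigma : R -> R),
  [/\ is_curve L eta, lip1 eta,
    (forall x y, `|sigma x - sigma y| <= `|x - y|) /\ `[0, L] `<=` sigma @` `[0, l],
    forall t, 0 <= t <= l -> gamma t = eta (sigma t) &
    sigma 0 = 0 /\ sigma l = L].
Proof.
move=> neq.
have L0 : 0 <= L by exact: arclength_ge0.
have /choice[tau tauP] : forall z, exists t, 0 <= t <= l /\ s t = clamp L z.
  by move=> z; apply: arclength_param_surj; exact: clamp_itv.
pose eta z := gamma (tau z).
have eta1 : lip1 eta.
  move=> x y; apply: le_trans (clamp_lip L _ _).
  by rewrite -!(tauP _).2; apply: mdist_arclength_param; exact: (tauP _).1.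
have sL t : 0 <= t <= l -> 0 <= s t <= L.
  move=> /andP[t0 tl]; rewrite /s clamp_id ?t0// arclength_ge0//=.
  by rewrite /L -(arclengthD gamma1 t0 tl) lerDl arclength_ge0.
have gE t : 0 <= t <= l -> gamma t = eta (s t).
  move=> tl; apply: mdist_positivity; apply/eqP; rewrite eq_le mdist_ge0 andbT.
  have := mdist_arclength_param tl (tauP (s t)).1.
  by rewrite (tauP _).2 clamp_id ?sL// subrr normr0.
have sT z : 0 <= z <= L -> exists2 t, 0 <= t <= l & s t = z.
  by move=> /arclength_param_surj[t [? ?]]; exists t.
exists L, eta, s; split => //; last 2 first.
- by split=> //; exact: arclength_param_lip.
- by rewrite arclength_param0 /s clamp_id ?lexx ?l0.
split => //.
- apply: continuous_subspaceT => x; apply/metricType_numDomainType.cvgrPdist_le => e e0; near=> y.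
  apply: le_trans (eta1 _ _) _; near: y.
  exact: (@cvgr_dist_le _ _ _ _ _ idfun x).
- exists (s 0), (s l); rewrite !in_itv/= !sL ?lexx ?l0//; split => //.
  by rewrite -!gE ?lexx ?l0.
- move=> x y x0 xy yL; apply/eqP; rewrite eq_le; apply/andP; split.
    by apply: (@curve_length_le _ idfun) => ? ? _ ? _; exact: lip1_mdist.
  rewrite curve_length_fin// lee_fin.
  move: (xy); rewrite le_eqVlt => /orP[/eqP ->|xlty].
    by rewrite subrr arclength_ge0.
  have [|t tl tx] := sT x; first by rewrite x0 (le_trans xy).
  have [|t' tl' ty] := sT y; first by rewrite yL (le_trans x0).
  have mono p q : 0 <= p <= l -> 0 <= q <= l -> p <= q -> s p <= s q.
    move=> /andP[p0 pl] /andP[q0 ql] pq.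
    by rewrite -subr_ge0 arclength_param_sub// arclength_ge0.
  have tt' : t <= t'.
    rewrite leNgt; apply/negP => t't; have := mono _ _ tl' tl (ltW t't).
    by rewrite tx ty leNgt xlty.
  move: (tl) (tl') => /andP[t0 tl1] /andP[t0' tl2].
  rewrite -{1}ty -{1}tx arclength_param_sub//.
  (* The length of [eta] from [x] to [s z], as a function of [z], has increments dominating
     distances along [gamma]. Hence the length y - x of [gamma] on [t, t'] is at most that of [eta]
     on [x, y]. *)
  have := @arclength_le _ gamma1 (fun z => arclength eta x (s z)) t t' tt'.
  have -> : arclength eta x (s t) = 0.
    rewrite tx; apply/eqP; rewrite eq_le arclength_ge0// andbT.
    by have := arclength_le_sub eta1 (lexx x); rewrite subrr.
  rewrite ty subr0; apply => p q tp pq qt'.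
  have pl : 0 <= p <= l by rewrite (le_trans t0 tp)/= (le_trans pq)// (le_trans qt').
  have ql : 0 <= q <= l by rewrite (le_trans qt' tl2) (le_trans _ pq)//; case/andP: pl.
  have sxp : x <= s p by rewrite -tx mono.
  rewrite -(arclengthD eta1 sxp (mono _ _ pl ql pq)) (gE p)// (gE q)//.
  by rewrite addrAC subrr add0r mdist_le_arclength// mono.
Unshelve. all: end_near. Qed.

End reparametrization.

End Curves.

(** * Borel functions and upper gradients along Lipschitz curves *)

Section BorelFunctions.
Context {R : realType} {d : measure_display} {P : metricMeasurableType d R}.
Implicit Types (f g u : P -> \bar R).

Lemma open_ball_metric (x : P) (r : R) : open (ball x r).
Proof.
rewrite openE => y; rewrite ballEmdist/= => xy.
apply/nbhs_ballP; exists (r - mdist x y)%R => /=; first by rewrite subr_gt0.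
by move=> z; rewrite !ballEmdist/=; have := metric_triangle x y z; lra.
Qed.

Lemma open_borel_set (A : set P) : open A -> borel_set A.
Proof. by move=> oA; exact: sub_sigma_algebra. Qed.

Lemma lsc_borel_fun g : lower_semicontinuous g -> borel_fun g.
Proof.
move=> lg; apply: (measurability _ (ErealGenOInfty.measurableE R)).
move=> /= _ [_ [a ->]] <-; rewrite setTI preimage_itvoy.
by apply: open_borel_set; move/lower_semicontinuousP : lg; exact.
Qed.

Lemma lip1_continuous (gamma : R -> P) : lip1 gamma -> continuous gamma.
Proof.
move=> gamma1 x; apply/metricType_numDomainType.cvgrPdist_le => e e0; near=> y.
apply: le_trans (gamma1 _ _) _; near: y.
exact: (@cvgr_dist_le _ _ _ _ _ idfun x).
Unshelve. all: end_near. Qed.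

Lemma borel_fun_curve g (gamma : R -> P) : borel_fun g -> lip1 gamma ->
  measurable_fun setT (g \o gamma : R -> \bar R).
Proof.
move=> bg /lip1_continuous cgamma.
have mgamma : measurable_fun setT (gamma : R -> g_sigma_algebraType (@open P)).
  apply: (@measurability _ _ _ (g_sigma_algebraType (@open P)) _ _ (@open P)) => //.
  move=> _ [A oA <-]; rewrite setTI.
  apply: open_measurable; apply: open_comp oA => x _; exact: cgamma.
exact: (measurableT_comp bg mgamma).
Qed.

Lemma curve_lip1 l (gamma : R -> P) : is_curve l gamma ->
  exists eta, lip1 eta /\ forall t, 0 <= t <= l -> eta t = gamma t.
Proof.
move=> cgamma; have l0 := curve_ge0 cgamma.
exists (gamma \o clamp l); split => [s t|t tl]; last by rewrite /= clamp_id.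
apply: le_trans (clamp_lip l _ _) => /=.
move: (clamp_itv s l0) (clamp_itv t l0).
move: (clamp l s) (clamp l t) => {s t} s t.
wlog st : s t / s <= t.
  move=> h sl tl; case/orP: (le_total s t) => st; first exact: h.
  by rewrite metric_sym distrC; exact: h.
move=> /andP[s0 sl] /andP[t0 tl].
rewrite -lee_fin; apply: le_trans (mdist_le_curve_length _ st) _.
by rewrite (curve_arclength cgamma)// distrC ger0_norm ?subr_ge0.
Qed.

Lemma measurable_curve g l (gamma : R -> P) : borel_fun g -> is_curve l gamma ->
  measurable_fun `[0, l] (fun t => g (gamma t)).
Proof.
move=> bg /curve_lip1[eta [eta1 etaE]].
apply: (eq_measurable_fun (g \o eta)).
  by move=> t; rewrite inE/= in_itv/= => /etaE <-.
by apply: measurable_funTS; exact: borel_fun_curve.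
Qed.

(** Passing to arc length does not increase the path integral. The end points are distinct because,
    for a constant map at a point where [u] is infinite, the convention on oo - oo would make the
    left side infinite. *)
Lemma upper_gradient_lip1 u g (gamma : R -> P) l : upper_gradient u g ->
  lip1 gamma -> 0 <= l -> gamma 0 <> gamma l ->
  (`|u (gamma 0%R) - u (gamma l)| <=
     \int[lebesgue_measure]_(t in `[0%R, l]) g (gamma t))%E.
Proof.
move=> [bg g0 ug] gamma1 l0 neq.
have [L [eta [s [ceta eta1 [s1 Ls] gE [s0 sl]]]]] := arclength_reparam gamma1 l0 neq.
have L0 := curve_ge0 ceta.
rewrite !gE ?lexx ?l0// s0 sl; apply: le_trans (ug _ _ ceta) _.
have := @le_integral_lipschitz _ s `[0%R, l] `[0%R, L] (g \o eta) s1
  (measurable_itv _) (measurable_itv _) Ls (borel_fun_curve bg eta1) (fun=> g0 _).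
move=> /le_trans; apply.
rewrite le_eqVlt; apply/orP; left; apply/eqP; apply: eq_integral => t.
by rewrite inE/= in_itv/= => tl; rewrite /= gE.
Qed.

End BorelFunctions.

(** * Limits of curves *)

Section LimitCurves.
Context {R : realType} {d : measure_display} {P : metricMeasurableType d R}.

Lemma ultra_compact_cvg (T : Type) (U : set_system T) (X : topologicalType)
    (f : T -> X) (K : set X) :
  UltraFilter U -> compact K -> (forall t, K (f t)) ->
  exists2 p, K p & f x @[x --> U] --> p.
Proof.
move=> UU cK Kf.
have PU : ProperFilter U by exact: ultra_proper.
have [|p [Kp clp]] := cK (f x @[x --> U]) _.
  have -> : (f x @[x --> U]) K = U setT.
    by congr U; apply/seteqP; split => // x _; exact: Kf.
  exact: filterT.
exists p => // V Vp; have [//|UV] := in_ultra_setVsetC (f @^-1` V) UU.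
by have [y [nVy Vy]] := clp (~` V) V UV Vp.
Qed.

(* Arzela-Ascoli: the pointwise limit along an ultrafilter, followed by the choice
   of indices close to that limit on ever finer grids. *)
Lemma curve_compactness (K : set P) (M : R) (gamma : nat -> R -> P)
    (l : nat -> R) :
  compact K -> (forall n, lip1 (gamma n)) -> (forall n t, K (gamma n t)) ->
  (forall n, 0 <= l n <= M) ->
  exists (gammaoo : R -> P) (loo : R) (phi : nat -> nat),
  [/\ lip1 gammaoo, 0 <= loo <= M, (forall n, (n <= phi n)%N),
    (forall t, 0 <= t <= M -> gamma (phi n) t @[n --> \oo] --> gammaoo t) &
    l (phi n) @[n --> \oo] --> loo].
Proof.
move=> cK gamma1 Kgamma lM.
have [U [UU FU]] := ultraFilterLemma (_ : ProperFilter \oo).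
have PU : ProperFilter U by exact: ultra_proper.
have /choice[g gP] : forall t : R, exists p : P, gamma n t @[n --> U] --> p.
  by move=> t; have [p _ ?] := ultra_compact_cvg UU cK (fun n => Kgamma n t); exists p.
have [|loo looM lloo] := ultra_compact_cvg UU (@segment_compact R 0 M) (_ : forall n, _ (l n)).
  by move=> n; rewrite /= in_itv/=; exact: lM.
have gPd t e : 0 < e -> U [set n | mdist (g t) (gamma n t) < e].
  by move=> e0; move/metricType_numDomainType.cvgrPdist_lt : (gP t); exact.
have lPd e : 0 < e -> U [set n | `|loo - l n| < e].
  by move=> e0; move/cvgrPdist_lt : (lloo); exact.
have g1 : lip1 g.
  move=> s t; apply/ler_addgt0Pr => e e0.
  have e20 : 0 < e / 2 by rewrite divr_gt0.
  have [n [/= ns nt]] := filter_ex (filterI (gPd s _ e20) (gPd t _ e20)).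
  have := gamma1 n s t; have := metric_triangle (g s) (gamma n s) (g t).
  have := metric_triangle (gamma n s) (gamma n t) (g t).
  by rewrite (metric_sym (gamma n t) (g t)); lra.
pose N n := (Num.truncn (M * n.+1%:R)).+1.
(* Finitely many grid conditions hold together on a set of the ultrafilter, which contains indices
   beyond [n]. This turns convergence along the ultrafilter into convergence of a sequence, the form
   required by Fatou's lemma. *)
have /choice[phi phiP] : forall n : nat, exists m : nat, [/\ (n <= m)%N,
   forall i : 'I_(N n), mdist (g (i%:R / n.+1%:R)) (gamma m (i%:R / n.+1%:R)) < n.+1%:R^-1 &
   `|loo - l m| < n.+1%:R^-1].
  move=> n; have n0 : 0 < n.+1%:R^-1 :> R by rewrite invr_gt0.
  have U1 : U [set m | (n <= m)%N] by apply: FU; exact: nbhs_infty_ge.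
  have U2 := lPd _ n0.
  have U3 : U [set m | forall i : 'I_(N n),
      mdist (g (i%:R / n.+1%:R)) (gamma m (i%:R / n.+1%:R)) < n.+1%:R^-1].
    by apply: filter_forall => i; exact: gPd.
  by have [m [[/= ? ?] ?]] := filter_ex (filterI (filterI U1 U2) U3); exists m.
exists g, loo, phi; split => //.
- by move=> n; have [] := phiP n.
- move=> t /andP[t0 tM]; apply/metricType_numDomainType.cvgrPdist_lt => e e0; near=> n.
  have [_ gn _] := phiP n.
  pose k := Num.truncn (t * n.+1%:R).
  have kN : (k < N n)%N by rewrite ltnS /k le_truncn// ler_wpM2r.
  have := gn (Ordinal kN); rewrite /=.
  have ge0 : 0 <= t * n.+1%:R by rewrite mulr_ge0.
  have /andP[kt tk] := truncn_itv ge0.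
  set q := k%:R / n.+1%:R => gq.
  have tq : `|t - q| <= n.+1%:R^-1.
    rewrite ger0_norm; last by rewrite subr_ge0 ler_pdivrMr.
    rewrite lerBlDr -[X in X + _]mul1r -mulrDl ler_pdivlMr//.
    by rewrite addrC natr1 ltW.
  have en : n.+1%:R^-1 < e / 3.
    near: n; exact: (@near_infty_natSinv_lt _ (PosNum (divr_gt0 e0 (ltr0n _ 3)))).
  have := g1 t q; have := gamma1 (phi n) q t; rewrite (distrC q).
  have := metric_triangle (g t) (g q) (gamma (phi n) t).
  have := metric_triangle (g q) (gamma (phi n) q) (gamma (phi n) t).
  by move: (n.+1%:R^-1) gq tq en => A gq tq en; lra.
- apply/cvgrPdist_lt => e e0; near=> n; have [_ _ ln] := phiP n.
  apply: lt_trans ln _; near: n; exact: (@near_infty_natSinv_lt _ (PosNum e0)).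
Unshelve. all: end_near. Qed.

Lemma lee_fin_lb (x y : \bar R) :
  (forall r : R, (r%:E < x)%E -> (r%:E <= y)%E) -> (x <= y)%E.
Proof.
move=> h; rewrite leNgt; apply/negP.
case: x y h => [r| |] [s| |] h //; rewrite ?lte_fin.
- by move=> sr; have := h ((r + s) / 2); rewrite lte_fin lee_fin; lra.
- by move=> _; have /h : ((r - 1)%:E < r%:E)%E by rewrite lte_fin; lra.
- by move=> _; have := h (s + 1); rewrite ltry lee_fin => /(_ isT); lra.
- by move=> _; have := h 0; rewrite ltry => /(_ isT).
Qed.

Lemma limn_einf_ge (u : nat -> \bar R) (x : \bar R) :
  (\forall n \near \oo, (x <= u n)%E) -> (x <= limn_einf u)%E.
Proof.
move=> [n _ xu]; rewrite limn_einf_lim (cvg_lim _ (@cvg_einfs_sup _ _))//.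
apply: le_trans (ereal_sup_ubound _); last by exists n.
by apply: le_ereal_inf_tmp => _ [m /= nm <-]; exact: xu.
Qed.

Lemma limn_einf_le (u : nat -> \bar R) (x : \bar R) :
  (forall n, (u n <= x)%E) -> (limn_einf u <= x)%E.
Proof.
move=> ux; rewrite limn_einf_lim (cvg_lim _ (@cvg_einfs_sup _ _))//.
apply: ge_ereal_sup => _ [n _ <-]; apply: le_trans (ux n).
by rewrite /einfs; apply: ereal_inf_lbound; exists n => //=.
Qed.

(** Fatou's lemma, for integrands cut off beyond [l n] so that all of them live on one domain; lower
    semicontinuity of [rho] bounds their lower limit from below by the value on the limit curve. *)
Lemma le_curve_integral_lim (rho : P -> \bar R) (gamma : nat -> R -> P)
    (goo : R -> P) (l : nat -> R) (loo M b : R) :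
  lower_semicontinuous rho -> (forall x, 0 <= rho x)%E ->
  (forall n, lip1 (gamma n)) -> lip1 goo ->
  (forall n, 0 <= l n <= M) -> 0 <= loo <= M ->
  (forall t, 0 <= t <= M -> gamma n t @[n --> \oo] --> goo t) ->
  l n @[n --> \oo] --> loo ->
  (forall n, \int[lebesgue_measure]_(t in `[0%R, l n]) rho (gamma n t) <= b%:E)%E ->
  (\int[lebesgue_measure]_(t in `[0%R, loo]) rho (goo t) <= b%:E)%E.
Proof.
move=> lrho rho0 gamma1 goo1 lM looM ggoo lloo gb.
have brho := lsc_borel_fun lrho.
have mF n : measurable_fun setT
    (fun t => rho (gamma n t) * (\1_(`[0%R, l n]%classic : set R) t)%:E)%E.
  apply: emeasurable_funM; first exact: borel_fun_curve.
  exact/measurable_EFinP/measurable_indic.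
have F0 n t : (0 <= rho (gamma n t) * (\1_(`[0%R, l n]%classic : set R) t)%:E)%E.
  by rewrite mule_ge0// lee_fin.
have mD : measurable (`[0, loo[%classic : set R) by [].
(* The end point is removed because only [t < loo] guarantees [t <= l n] eventually, hence a cut-off
   equal to 1. *)
rewrite -integral_itv_bndo_bndc; last first.
  by apply: measurable_funTS; exact: borel_fun_curve.
apply: (@le_trans _ _ (\int[lebesgue_measure]_(t in `[0%R, loo[)
    limn_einf (fun n => rho (gamma n t) * (\1_(`[0%R, l n]%classic : set R) t)%:E))%E); last first.
  have := fatou lebesgue_measure mD (fun n => measurable_funTS (mF n))
    (fun n x _ => F0 n x).
  move=> /le_trans; apply.
  apply: limn_einf_le => n; apply: le_trans (gb n).
  rewrite [leRHS]integral_mkcond.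
  apply: (@le_trans _ _ (\int[lebesgue_measure]_t
      (rho (gamma n t) * (\1_(`[0%R, l n]%classic : set R) t)%:E))%E).
    apply: ge0_subset_integral => //; exact: mF.
  by rewrite epatch_indic.
apply: ge0_le_integral => //.
- by apply: measurable_funTS; exact: borel_fun_curve.
- rewrite (_ : (fun t => _) = (fun t => - limn_esup (fun n =>
    - (rho (gamma n t) * (\1_(`[0%R, l n]%classic : set R) t)%:E)))%E).
    apply: measurableT_comp => //; apply: measurable_fun_limn_esup => n.
    by apply: measurableT_comp => //; exact: (measurable_funTS (mF n)).
  by apply/funext => t; rewrite -limn_einfN; congr limn_einf; apply/funext => n /=; rewrite oppeK.
move=> t; rewrite /= in_itv/= => /andP[t0 tl].
have tM : 0 <= t <= M by rewrite t0/= (le_trans (ltW tl))//; case/andP: looM.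
suff h r : (r%:E < rho (goo t))%E -> (r%:E <=
    limn_einf (fun n => rho (gamma n t) * (\1_(`[0%R, l n]%classic : set R) t)%:E))%E.
  by apply: lee_fin_lb => r; exact: h.
move=> /lrho[V Vgoo Vr]; apply: limn_einf_ge; near=> n.
have tln : t <= l n.
  near: n; apply: cvgr_ge lloo _ tl.
rewrite indicE mem_set ?mule1; last by rewrite /= in_itv/= t0.
apply/ltW/Vr; near: n; exact: (ggoo t tM).
Unshelve. all: end_near. Qed.

End LimitCurves.

(** * The infimum of path integrals *)

Section PathFunction.
Context {R : realType} {d : measure_display} {P : metricMeasurableType d R}.
Variables (W : set P) (rho : P -> \bar R).
Implicit Types (gamma : R -> P) (l : R).
Hypotheses (oW : open W) (brho : borel_fun rho) (rho0 : forall x, (0 <= rho x)%E).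

Lemma first_exit (gamma : R -> P) (l : R) : lip1 gamma -> 0 <= l ->
  W (gamma 0) -> ~ W (gamma l) ->
  exists l', [/\ 0 < l' <= l, ~ W (gamma l') & forall t, 0 <= t < l' -> W (gamma t)].
Proof.
move=> gamma1 l0 W0 Wl.
pose S := [set t : R | 0 <= t /\ ~ W (gamma t)].
have Sl : S l by [].
have lbS : lbound S 0 by move=> t [].
have hS : has_inf S by split; [exists l|exists 0].
have infl : inf S <= l by exact: ge_inf hS.2 _ Sl.
have inf0 : 0 <= inf S by apply: lb_le_inf => //; exists l.
have Winf : ~ W (gamma (inf S)).
  move=> WI.
  have /nbhs_ballP[e /= e0 eW] : nbhs (inf S) (gamma @^-1` W).
    by apply: (lip1_continuous gamma1); exact: open_nbhs_nbhs.
  have [t [t0 Wt] tI] := inf_adherent e0 hS.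
  have It : inf S <= t by exact: (ge_inf hS.2 (conj t0 Wt)).
  by apply: Wt; apply: eW; rewrite /ball/= distrC ger0_norm ?subr_ge0//; lra.
exists (inf S); split => //.
  rewrite infl andbT lt_neqAle inf0 andbT; apply/eqP => I0.
  by apply: Winf; rewrite -I0.
move=> t /andP[t0 tI]; apply: contrapT => Wt.
have : inf S <= t by exact: (ge_inf hS.2 (conj t0 Wt)).
by rewrite leNgt tI.
Qed.

Lemma dist_subl l (s t : R) : `|l - s - (l - t)| = `|s - t|.
Proof. by rewrite -normrN; congr (`|_|); ring. Qed.

Lemma lee_dist (x y c : \bar R) : x \is a fin_num -> y \is a fin_num ->
  (x <= y + c)%E -> (y <= x + c)%E -> (`|x - y| <= c)%E.
Proof.
case: x y c => [x| |] // [y| |] // [c| |] //= _ _; rewrite ?leey ?leeNy_eq//.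
by rewrite -!EFinD !lee_fin ler_norml; lra.
Qed.

Definition path_cost (gamma : R -> P) (l : R) : \bar R :=
  (\int[lebesgue_measure]_(t in `[0%R, l]) rho (gamma t))%E.

(** Competitors are 1-Lipschitz and possibly constant: they can be concatenated, reversed and passed
    to limits, and a point outside [W] has a competitor of cost 0. *)
Definition path_costs (x : P) : set (\bar R) :=
  [set path_cost p.1 p.2 | p in
    [set p : (R -> P) * R | [/\ lip1 p.1, 0 <= p.2, p.1 0 = x & ~ W (p.1 p.2)]]].

(** The bound 1 keeps the values finite even where no path leaves [W], so that the convention on oo
    - oo is never met. *)
Definition path_fun (x : P) : \bar R := mine 1%E (ereal_inf (path_costs x)).

Lemma path_cost_ge0 gamma l : (0 <= path_cost gamma l)%E.
Proof. exact: integral_ge0. Qed.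

Lemma path_fun_ge0 x : (0 <= path_fun x)%E.
Proof.
rewrite /path_fun le_min lee01/=; apply: le_ereal_inf_tmp => _ [p _ <-].
exact: path_cost_ge0.
Qed.

Lemma path_fun_le1 x : (path_fun x <= 1)%E.
Proof. by rewrite /path_fun ge_min lexx. Qed.

Lemma path_fun_fin_num x : path_fun x \is a fin_num.
Proof.
by rewrite ge0_fin_numE ?path_fun_ge0// (le_lt_trans (path_fun_le1 x))// ltry.
Qed.

Lemma path_fun_le_cost gamma l : lip1 gamma -> 0 <= l -> ~ W (gamma l) ->
  (path_fun (gamma 0%R) <= path_cost gamma l)%E.
Proof.
move=> gamma1 l0 Wl; rewrite /path_fun ge_min; apply/orP; right.
by apply: ereal_inf_lbound; exists (gamma, l).
Qed.

Lemma path_fun_out x : ~ W x -> path_fun x = 0%E.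
Proof.
move=> Wx; apply/eqP; rewrite eq_le path_fun_ge0 andbT.
have c1 : lip1 (fun=> x) by move=> s t; rewrite mdistxx.
have := @path_fun_le_cost (fun=> x) 0 c1 (lexx _) Wx.
by rewrite /path_cost set_itv1 integral_set1.
Qed.

Lemma measurable_path gamma (D : set R) : lip1 gamma ->
  measurable_fun D (fun t => rho (gamma t)).
Proof. by move=> gamma1; apply: measurable_funTS; exact: borel_fun_curve. Qed.

(** Prefixing [gamma] to a competitor [beta] for its end point gives a competitor [eta] for its
    starting point, whose cost is at most the sum of the two costs. *)
Lemma path_fun_le_add gamma l : lip1 gamma -> 0 <= l ->
  (path_fun (gamma 0%R) <= path_fun (gamma l) + path_cost gamma l)%E.
Proof.
move=> gamma1 l0.
have [->|Cfin] := eqVneq (path_cost gamma l) +oo%E.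
  by rewrite addey ?leey// -ltNye (lt_le_trans _ (path_fun_ge0 _)).
have {}Cfin : path_cost gamma l \is a fin_num.
  by rewrite ge0_fin_numE ?path_cost_ge0// ltey.
rewrite -leeBlDr// {2}/path_fun le_min; apply/andP; split.
  by rewrite leeBlDr// (le_trans (path_fun_le1 _))// leeDl// path_cost_ge0.
apply: le_ereal_inf_tmp => _ [[beta m] /= [beta1 m0 beta0 Wm] <-].
rewrite leeBlDr//.
pose eta t := if t <= l then gamma t else beta (t - l).
have eta1 : lip1 eta.
  move=> s t; wlog st : s t / s <= t.
    move=> h; case/orP: (le_total s t) => st; first exact: h.
    by rewrite metric_sym distrC; exact: h.
  rewrite distrC ger0_norm ?subr_ge0//.
  rewrite /eta; case: (leP s l) => sl; case: (leP t l) => tl.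
  - exact: lip1_mdist.
  - apply: le_trans (metric_triangle _ (gamma l) _) _.
    have := lip1_mdist gamma1 sl; have : 0 <= t - l by lra.
    by move=> /(lip1_mdist beta1); rewrite beta0; lra.
  - by move: sl; rewrite ltNge (le_trans st tl).
  - by apply: le_trans (lip1_mdist beta1 _) _; lra.
have eta0 : eta 0 = gamma 0 by rewrite /eta l0.
have etaE : eta (l + m) = beta m.
  rewrite /eta; case: ifPn => lm; last by rewrite addrAC subrr add0r.
  have -> : m = 0 by lra.
  by rewrite addr0 beta0.
rewrite -eta0; apply: le_trans (@path_fun_le_cost eta (l + m) eta1 _ _) _.
- by rewrite addr_ge0.
- by rewrite etaE.
rewrite /path_cost.
rewrite (_ : `[0, l + m]%classic = `[0, l] `|` `]l, l + m])%classic; last first.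
  by rewrite -itv_bndbnd_setU// bnd_simp// lerDl.
rewrite ge0_integral_setU//=; last 2 first.
- exact: measurable_path.
- by rewrite disj_set2E; apply/eqP/seteqP; split => // x /= []; rewrite !in_itv/=; lra.
rewrite addeC; apply: leeD.
- have := @le_integral_lipschitz _ (fun t => t + l) `[0, m] `]l, l + m] (rho \o eta) _
    (measurable_itv _) (measurable_itv _) _ (borel_fun_curve brho eta1) (fun=> rho0 _).
  move=> /(_ _ _)/le_trans; apply.
  + by move=> x y; rewrite opprD addrACA subrr addr0.
  + by move=> x /=; rewrite in_itv/= => /andP[lx xm]; exists (x - l);
      rewrite ?subrK// in_itv/=; lra.
  rewrite le_eqVlt; apply/orP; left; apply/eqP; apply: eq_integral => t.
  rewrite inE/= in_itv/= => /andP[t0 tm]; rewrite /eta.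
  case: ifPn => tl; last by rewrite addrK.
  have -> : t = 0 by lra.
  by rewrite add0r beta0.
- rewrite le_eqVlt; apply/orP; left; apply/eqP; apply: eq_integral => t.
  by rewrite inE/= in_itv/= /eta => /andP[_ ->].
Qed.

Lemma path_cost_reverse gamma l : lip1 gamma -> 0 <= l ->
  (path_cost (fun t => gamma (l - t)%R) l <= path_cost gamma l)%E.
Proof.
move=> gamma1 l0.
have rev1 : lip1 (fun t => gamma (l - t)).
  by move=> s t; apply: le_trans (gamma1 _ _) _; rewrite dist_subl.
have := @le_integral_lipschitz _ (fun t => l - t) `[0, l] `[0, l]
  (rho \o (fun t => gamma (l - t))) _
    (measurable_itv _) (measurable_itv _) _ (borel_fun_curve brho rev1) (fun=> rho0 _).
move=> /(_ _ _)/le_trans; apply.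
- by move=> x y; rewrite dist_subl.
- by move=> x /=; rewrite in_itv/= => /andP[x0 xl]; exists (l - x); rewrite ?subKr// in_itv/=; lra.
rewrite le_eqVlt; apply/orP; left; apply/eqP; apply: eq_integral => t _.
by rewrite /= subKr.
Qed.

Lemma path_fun_upper_gradient : upper_gradient path_fun rho.
Proof.
split => // l gamma cgamma; have l0 := curve_ge0 cgamma.
have [eta [eta1 etaE]] := curve_lip1 cgamma.
have -> : (\int[lebesgue_measure]_(t in `[0%R, l]) rho (gamma t) = path_cost eta l)%E.
  by apply: eq_integral => t; rewrite inE/= in_itv/= => tl; rewrite etaE.
rewrite -!etaE ?lexx ?l0//.
apply: lee_dist; rewrite ?path_fun_fin_num//; first exact: path_fun_le_add.
have rev1 : lip1 (fun t => eta (l - t)).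
  by move=> s t; apply: le_trans (eta1 _ _) _; rewrite dist_subl.
have := path_fun_le_add rev1 l0; rewrite subrr subr0 => /le_trans; apply.
by rewrite leeD2l// path_cost_reverse.
Qed.

End PathFunction.

Section PathFunctionSemicontinuity.
Context {R : realType} {d : measure_display} {P : metricMeasurableType d R}.
Variables (W K : set P) (rho : P -> \bar R) (a : R).
Implicit Types (gamma : R -> P) (l : R).
Hypotheses (oW : open W) (lrho : lower_semicontinuous rho)
  (rho0 : forall x, (0 <= rho x)%E) (cK : compact K) (clK : closed K)
  (WK : W `<=` K) (a0 : 0 < a) (rhoa : forall x, W x -> (a%:E <= rho x)%E).

Let brho := lsc_borel_fun lrho.

Lemma path_cost_subset gamma l l' : lip1 gamma -> l' <= l ->
  (path_cost rho gamma l' <= path_cost rho gamma l)%E.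
Proof.
move=> gamma1 ll'; apply: ge0_subset_integral => //.
- exact: measurable_path.
- by move=> t /=; rewrite !in_itv/= => /andP[-> tl]; rewrite (le_trans tl).
Qed.

Lemma path_cost_ge_length gamma l : lip1 gamma -> 0 <= l ->
  (forall t, 0 <= t < l -> W (gamma t)) -> ((a * l)%:E <= path_cost rho gamma l)%E.
Proof.
move=> gamma1 l0 Wg; rewrite /path_cost -integral_itv_bndo_bndc; last first.
  exact: measurable_path.
apply: (@le_trans _ _ (\int[lebesgue_measure]_(t in `[0%R, l[) (cst a%:E) t)%E).
  rewrite integral_cst//= lebesgue_measure_itv/= lte_fin.
  case: ifPn => [_|l00]; first by rewrite -EFinD -EFinM subr0.
  by rewrite mule0 lee_fin pmulr_rle0// leNgt.
apply: ge0_le_integral => //.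
- by move=> t _; rewrite lee_fin ltW.
- exact: measurable_path.
- by move=> t /=; rewrite in_itv/= => tl; apply: rhoa; exact: Wg.
Qed.

(** Stopping at the first exit from [W] supplies the two hypotheses of [curve_compactness]: the path
    stays in [K], and since [rho] is at least [a] before the exit, its length is at most its cost
    divided by [a]. *)
Lemma path_truncate gamma l : lip1 gamma -> 0 <= l ->
  W (gamma 0) -> ~ W (gamma l) ->
  exists eta l', [/\ lip1 eta /\ (forall t, K (eta t)), 0 <= l',
    eta 0 = gamma 0, ~ W (eta l') &
    (path_cost rho eta l' <= path_cost rho gamma l)%E /\
    ((a * l')%:E <= path_cost rho eta l')%E].
Proof.
move=> gamma1 l0 W0 Wl.
have [l' [/andP[l'0 l'l] Wl' Wt]] := first_exit oW gamma1 l0 W0 Wl.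
pose eta t := gamma (clamp l' t).
have etaE t : 0 <= t <= l' -> eta t = gamma t by move=> tl; rewrite /eta clamp_id.
have eta1 : lip1 eta by move=> s t; apply: le_trans (clamp_lip l' _ _); exact: gamma1.
have l'0' := ltW l'0.
exists eta, l'; split => //.
- split => // t; rewrite /eta; have /andP[c0 cl] := clamp_itv t l'0'.
  move: cl; rewrite le_eqVlt => /orP[/eqP ->|cl]; last by apply/WK/Wt; rewrite c0.
  (* The exit point is outside [W]; it belongs to the closed set [K] as a limit of points of [W]. *)
  have cg : gamma t @[t --> l'^'-] --> gamma l'.
    by apply: cvg_at_left_filter; exact: (lip1_continuous gamma1).
  apply: (closed_cvg K clK _ _ cg); near=> t'; apply/WK/Wt.
  by apply/andP; split => //; near: t'; apply: nbhs_left_ge.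
- by rewrite etaE// lexx.
- by rewrite etaE// lexx andbT.
split.
  apply: le_trans (path_cost_subset gamma1 l'l).
  rewrite le_eqVlt; apply/orP; left; apply/eqP; apply: eq_integral => t.
  by rewrite inE/= in_itv/= => tl; rewrite etaE.
apply: path_cost_ge_length => // t /andP[t0 tl].
by rewrite etaE ?t0 ?ltW//; apply: Wt; rewrite t0.
Unshelve. all: end_near. Qed.

(** If semicontinuity failed at [x], points [y n] tending to [x] would have exit paths of cost at
    most [b], with [b] below the value at [x]. A limit of these paths starts at [x], ends in the
    closed complement of [W] and costs at most [b], a contradiction. *)
Lemma path_fun_lsc : lower_semicontinuous (path_fun W rho).
Proof.
move=> x r rx.
have [r0|r0] := ltP r 0.
  exists setT; first exact: filterT.
  by move=> y _; apply: lt_le_trans (path_fun_ge0 _ rho0 _); rewrite lte_fin.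
have Wx : W x.
  by apply: contrapT => /(path_fun_out rho0) h; move: rx; rewrite h lte_fin ltNge r0.
have [b [rb bx]] : exists b, r < b /\ (b%:E < path_fun W rho x)%E.
  have := path_fun_fin_num W rho0 x.
  case: (path_fun W rho x) rx => [s| |]//; rewrite lte_fin => rs _.
  by exists ((r + s) / 2); rewrite lte_fin; lra.
apply: contrapT => nV.
have [e0 /= e00 eW] : exists2 e, 0 < e & ball x e `<=` W.
  by apply/nbhs_ballP; exact: open_nbhs_nbhs.
have /choice[y yP] : forall n : nat, exists y : P,
    [/\ mdist x y < e0, mdist x y < n.+1%:R^-1 & (path_fun W rho y <= r%:E)%E].
  move=> n; apply: contrapT => nex; apply: nV.
  exists (ball x (Num.min e0 n.+1%:R^-1)).
    by apply: nbhsx_ballx; rewrite lt_min e00 invr_gt0 ltr0n.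
  move=> z; rewrite ballEmdist/= lt_min => /andP[ze zn].
  by rewrite ltNge; apply/negP => zr; apply: nex; exists z.
(* Since [b] is below 1, a value of [path_fun] below [b] comes from an actual path and not from the
   truncation at 1. *)
have b1 : b < 1 by rewrite -lte_fin (lt_le_trans bx)// path_fun_le1.
have /choice[p pP] : forall n : nat, exists p : (R -> P) * R,
    [/\ lip1 p.1 /\ (forall t, K (p.1 t)), 0 <= p.2 <= b / a, p.1 0 = y n,
      ~ W (p.1 p.2) & (path_cost rho p.1 p.2 <= b%:E)%E].
  move=> n; have [ye _ yr] := yP n.
  have /(le_lt_trans yr) : (r%:E < b%:E)%E by rewrite lte_fin.
  have /negPf b1F : ~~ (1 < b%:E)%E by rewrite lte_fin -leNgt ltW.
  rewrite /path_fun gt_min b1F/= => /ereal_inf_lt[_ [[g l] /=[g1 l0 g0 Wl] <-] cb].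
  have [|eta [l' [eta1 l'0 eta0 Wl' [c1 c2]]]] := path_truncate g1 l0 _ Wl.
    by rewrite g0; apply: eW; rewrite ballEmdist.
  have ceb : (path_cost rho eta l' <= b%:E)%E by rewrite (le_trans c1)// ltW.
  exists (eta, l'); split => //=; rewrite ?eta0//.
  rewrite l'0/= ler_pdivlMr// mulrC -lee_fin.
  exact: le_trans c2 ceb.
have [||| g [l [phi [g1 lM phin gphi lphi]]]] :=
  @curve_compactness _ _ _ K (b / a) (fun n => (p n).1) (fun n => (p n).2) cK.
- by move=> n; have [[]] := pP n.
- by move=> n; have [[]] := pP n.
- by move=> n; have [] := pP n.
have b0 : 0 <= b / a by apply: divr_ge0; [exact: le_trans r0 (ltW rb)|exact: ltW].
have g0 : g 0 = x.
  apply: (@cvg_unique _ (metric_hausdorff (T := P)) ((p (phi n)).1 0 @[n --> \oo])).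
    by apply: gphi; rewrite lexx.
  apply/metricType_numDomainType.cvgrPdist_lt => e e1; near=> n.
  have [_ _ -> _ _] := pP (phi n); have [_ yx _] := yP (phi n).
  apply: lt_trans yx _; near: n.
  have [m _ mP] := @near_infty_natSinv_lt R (PosNum e1).
  by exists m => // n /= mn; apply: mP; exact: leq_trans mn (phin n).
have Wgl : ~ W (g l).
  suff : (~` W) (g l) by [].
  have cg : (p (phi n)).1 (p (phi n)).2 @[n --> \oo] --> g l.
    apply/metricType_numDomainType.cvgrPdist_lt => e e1; near=> n.
    have [[p1 _] _ _ _ _] := pP (phi n).
    have h1 := p1 l (p (phi n)).2.
    have h2 := metric_triangle (g l) ((p (phi n)).1 l) ((p (phi n)).1 (p (phi n)).2).
    have h3 : mdist (g l) ((p (phi n)).1 l) < e / 2.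
      near: n; move: (gphi l lM) => /metricType_numDomainType.cvgrPdist_lt; apply.
      by rewrite divr_gt0.
    have h4 : `|l - (p (phi n)).2| < e / 2.
      by near: n; move: lphi => /cvgrPdist_lt; apply; rewrite divr_gt0.
    lra.
  apply: (closed_cvg (~` W) _ _ _ cg); first exact: open_closedC.
  by apply: nearW => n; have [] := pP (phi n).
have l0 : 0 <= l by case/andP: lM.
have := @path_fun_le_cost _ _ _ W rho g l g1 l0 Wgl.
rewrite g0 leNgt => /negP; apply; apply: le_lt_trans bx.
apply: (@le_curve_integral_lim _ _ _ rho (fun n => (p (phi n)).1) g
  (fun n => (p (phi n)).2) l (b / a) b) => //.
- by move=> n; have [[]] := pP (phi n).
- by move=> n; have [] := pP (phi n).
- by move=> n; have [] := pP (phi n).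
Unshelve. all: end_near. Qed.

Lemma path_fun_eq1 x :
  (forall gamma l, lip1 gamma -> 0 <= l -> gamma 0 = x -> ~ W (gamma l) ->
    (1 <= path_cost rho gamma l)%E) -> path_fun W rho x = 1%E.
Proof.
move=> h; rewrite /path_fun min_l//; apply: le_ereal_inf_tmp => _ [[g l] /= [? ? ? ?] <-].
exact: h.
Qed.

End PathFunctionSemicontinuity.

(** * Capacity in a function lattice *)

Section FunctionLattice.
Context {R : realType} {d : measure_display} {P : metricMeasurableType d R}.
Variables (mu : {measure set P -> \bar R}) (c : R) (N : (P -> \bar R) -> \bar R).
Hypotheses (hP : metric_measure_space mu)
  (hX : quasi_banach_function_lattice mu c N).
Implicit Types (u v w g h : P -> \bar R).
Local Open Scope ereal_scope.

Lemma borel_measurable g : borel_fun g -> measurable_fun setT g.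
Proof.
move=> bg mT Y mY; rewrite setTI; apply: mms_borel hP _ _.
by rewrite -[X in borel_set X]setTI; exact: bg.
Qed.

Lemma lsc_measurable g : lower_semicontinuous g -> measurable_fun setT g.
Proof. by move=> /lsc_borel_fun/borel_measurable. Qed.

Lemma norm_le u v : measurable_fun setT u -> measurable_fun setT v ->
  (forall x, `|u x| <= `|v x|) -> N u <= N v.
Proof. by move=> mu_ mv uv; apply: qbfl_lattice hX _ _ mu_ mv _; exact: aeW. Qed.

Lemma ge0_norm_le u v : measurable_fun setT u -> measurable_fun setT v ->
  (forall x, 0 <= u x) -> (forall x, u x <= v x) -> N u <= N v.
Proof.
move=> mu_ mv u0 uv; apply: norm_le => // x.
by rewrite !gee0_abs// (le_trans (u0 x)).
Qed.

Lemma norm_scale_le (a b : R) u : measurable_fun setT u -> (0 <= a)%R ->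
  N u <= b%:E -> N (fun x => a%:E * u x) <= (a * b)%:E.
Proof.
move=> mu_ a0 ub; rewrite (qbfl_homogeneous hX)// EFinM ger0_norm//.
by rewrite lee_wpmul2l.
Qed.

Let c1 : (1 <= c)%R := qbfl_modulus_ge1 hX.
Let c0 : (0 < c)%R := lt_le_trans ltr01 c1.

Lemma norm_add_le (a b : R) u v : measurable_fun setT u -> measurable_fun setT v ->
  N u <= a%:E -> N v <= b%:E -> N (u \+ v) <= (c * (a + b))%:E.
Proof.
move=> mu_ mv ua vb; apply: le_trans (qbfl_triangle hX mu_ mv) _.
by rewrite EFinM lee_wpmul2l ?lee_fin ?(ltW c0)// EFinD leeD.
Qed.

(** The Riesz-Fischer inequality, indexed from 1, puts the weight [c ^+ n.+1] on [u_ n]. The assumed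
    bound leaves b / 2^(n+1), which sums to [b]; this is the origin of every factor
    [(2 * c) ^+ n.+1] below. *)
Lemma norm_series_le (u_ : nat -> P -> \bar R) (b : R) : (0 <= b)%R ->
  (forall n, measurable_fun setT (u_ n)) -> (forall n x, 0 <= u_ n x) ->
  (forall n, N (u_ n) <= (b / (2 * c) ^+ n.+1)%:E) ->
  N (fun x => \sum_(n <oo) u_ n x) <= b%:E.
Proof.
move=> b0 mu_ u0 ub.
have := qbfl_riesz_fischer hX (fun n => mu_ n.-1)
  (fun n => aeW mu (u0 n.-1)).
rewrite (_ : (fun x => \sum_(1 <= n <oo) u_ n.-1 x) = (fun x => \sum_(n <oo) u_ n x)); last first.
  apply/funext => x; rewrite -(@nneseries_addn _ (fun n => u_ n.-1 x) 1)//.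
  by apply: eq_eseriesr => n _; rewrite addn1.
move=> /le_trans; apply; apply: le_trans (epsilon_trick0 xpredT b0).
rewrite -(@nneseries_addn _ (fun n => (c ^+ n)%:E * N (u_ n.-1)) 1); last first.
  move=> n; rewrite mule_ge0// ?(qbfl_ge0 hX)// lee_fin exprn_ge0//.
  exact: ltW.
apply: lee_nneseries => n _.
  rewrite mule_ge0// ?(qbfl_ge0 hX)// lee_fin exprn_ge0//; exact: ltW.
rewrite addn1/=.
apply: (@le_trans _ _ ((c ^+ n.+1)%:E * (b / (2 * c) ^+ n.+1)%:E)).
  by rewrite lee_wpmul2l// lee_fin exprn_ge0// ltW.
rewrite -EFinM lee_fin exprMn natrX invfM mulrCA [X in (b * X <= _)%R]mulrC.
by rewrite -mulrA mulVf ?mulr1// expf_neq0// gt_eqF.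
Qed.

(* Test functions with values in [0, 1] suffice for the capacity, by truncation;
   their suprema are finite, so that the convention on oo - oo plays no role. *)
Definition cap_le (A : set P) (b : R) := exists h g,
  [/\ measurable_fun setT h, forall x, 0 <= h x <= 1,
      forall x, A x -> h x = 1, upper_gradient h g & N h <= b%:E /\ N g <= b%:E].

Lemma cap_le_capacity A b : cap_le A b -> capacity N A <= (b + b)%:E.
Proof.
move=> [h [g [mh h01 hA ug [hb gb]]]].
apply: (@le_trans _ _ (N1norm N h)).
  by apply: ereal_inf_lbound; exists h => //; split => // x /hA ->.
rewrite EFinD leeD//; apply: le_trans gb; apply: ereal_inf_lbound.
by exists g.
Qed.

Lemma cap_leS A B a b : A `<=` B -> (a <= b)%R -> cap_le B a -> cap_le A b.
Proof.
move=> AB ab [h [g [mh h01 hA ug [hb gb]]]]; exists h, g; split => //.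
  by move=> x /AB/hA.
by split; [apply: le_trans hb _|apply: le_trans gb _]; rewrite lee_fin.
Qed.

Lemma upper_gradient_measurable u g : upper_gradient u g -> measurable_fun setT g.
Proof. by move=> [bg _ _]; exact: borel_measurable. Qed.

Lemma N1norm_lt w (e : R) : measurable_fun setT w -> N1norm N w < e%:E ->
  exists g, [/\ upper_gradient w g, N w <= e%:E & N g <= e%:E].
Proof.
move=> mw we.
have i0 : 0 <= ereal_inf [set N g | g in upper_gradient w].
  apply: le_ereal_inf_tmp => _ [g ug <-].
  by apply: (qbfl_ge0 hX); exact: upper_gradient_measurable ug.
have w0 : 0 <= N w by exact: (qbfl_ge0 hX).
have : ereal_inf [set N g | g in upper_gradient w] < e%:E.
  by apply: le_lt_trans we; rewrite leeDr.
move=> /ereal_inf_lt[_ [g ug <-] ge]; exists g; split => //; last exact: ltW.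
by apply: le_trans (ltW we); rewrite leeDl.
Qed.

Lemma lee_abs_shift (x y : \bar R) : `|x| <= `|y| + `|x - y|.
Proof.
case: x y => [x| |] [y| |]; rewrite ?leey// /=.
by rewrite -!EFinD lee_fin; have := ler_normD (x - y)%R y; rewrite subrK; lra.
Qed.

Lemma le_mine1D (x y z : \bar R) : 0 <= z -> x <= y + z ->
  mine 1 x <= mine 1 y + z.
Proof.
move=> z0 xyz; rewrite /mine; case: ifPn => x1; case: ifPn => y1.
- by rewrite leeDl.
- by apply: le_trans (ltW x1) xyz.
- by rewrite (@le_trans _ _ 1)// ?leeDl// leNgt.
- by [].
Qed.

(** Chebyshev's argument, with test function min(1, |w| / t) and upper gradient g / t. *)
Lemma cap_le_weak w g (t b : R) : measurable_fun setT w -> upper_gradient w g ->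
  (0 < t)%R -> N w <= (t * b)%:E -> N g <= (t * b)%:E ->
  cap_le [set x | t%:E <= `|w x|] b.
Proof.
move=> mw ug t0 wb gb; have mg := upper_gradient_measurable ug.
have ti0 : (0 <= t^-1)%R by rewrite invr_ge0 ltW.
have bE : b = (t^-1 * (t * b))%R by rewrite mulrA mulVf ?mul1r// gt_eqF.
pose h x := mine 1 `|t^-1%:E * w x|.
have mtw : measurable_fun setT (fun x => t^-1%:E * w x).
  by apply: emeasurable_funM.
have mh : measurable_fun setT h.
  by apply: measurable_mine => //; exact: measurableT_comp.
have h01 x : 0 <= h x <= 1 by rewrite /h le_min lee01 abse_ge0/= ge_min lexx.
have hfin x : h x \is a fin_num.
  have /andP[? ?] := h01 x; by rewrite ge0_fin_numE// (@le_lt_trans _ _ 1)// ltry.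
exists h; exists (fun x => t^-1%:E * g x); split => //.
- move=> x /= tw; rewrite /h min_l// abseM gee0_abs ?lee_fin//.
  rewrite -(@lee_pmul2l _ t%:E)// ?lte_fin// mule1 muleA -EFinM divff ?gt_eqF//.
  by rewrite mul1e.
- case: ug => bg g0 ug; split.
  + by apply: emeasurable_funM.
  + by move=> x; rewrite mule_ge0// lee_fin.
  + move=> l gamma cg; rewrite ge0_integralZl_EFin//; last exact: measurable_curve.
    have key x y : `|w x - w y| <= \int[lebesgue_measure]_(s in `[0%R, l]) g (gamma s) ->
        h x <= h y + t^-1%:E * \int[lebesgue_measure]_(s in `[0%R, l]) g (gamma s).
      move=> wxy; apply: le_mine1D.
        by apply: mule_ge0; [rewrite lee_fin|exact: integral_ge0].
      apply: (@le_trans _ _ (t^-1%:E * (`|w y| + `|w x - w y|))).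
        by rewrite abseM gee0_abs ?lee_fin// lee_wpmul2l// ?lee_fin// lee_abs_shift.
      rewrite ge0_muleDr// abseM [`|t^-1%:E|]gee0_abs ?lee_fin//.
      by rewrite leeD2l// lee_wpmul2l// lee_fin.
    have := ug _ _ cg => ugc; apply: lee_dist => //; apply: key => //.
    rewrite (_ : `|_ - _| = `|w (gamma 0%R) - w (gamma l)|)//.
    by case: (w (gamma 0%R)) (w (gamma l)) => [x| |] [y| |]//=; rewrite distrC.
- split.
    rewrite bE; apply: (@le_trans _ _ (N (fun x => t^-1%:E * w x))); last exact: norm_scale_le.
    apply: norm_le => // x; have /andP[h0 _] := h01 x.
    by rewrite gee0_abs// ge_min lexx orbT.
  by rewrite bE; exact: norm_scale_le.
Qed.

(** The supremum of the test functions stays in [0, 1] and has the sum of their upper gradients as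
    an upper gradient; it is itself dominated by the sum of the test functions, so [norm_series_le]
    bounds both. *)
Lemma cap_le_bigcup (A : nat -> set P) (b : R) : (0 <= b)%R ->
  (forall n, cap_le (A n) (b / (2 * c) ^+ n.+1)) -> cap_le (\bigcup_n A n) b.
Proof.
move=> b0 /choice[h] /choice[g] hg.
have mh n : measurable_fun setT (h n) by have [] := hg n.
have h0 n x : 0 <= h n x by have [_ /(_ x)/andP[]] := hg n.
have h1 n x : h n x <= 1 by have [_ /(_ x)/andP[]] := hg n.
have ug n : upper_gradient (h n) (g n) by have [] := hg n.
have g0 n x : 0 <= g n x by have [] := ug n.
have mg n := upper_gradient_measurable (ug n).
pose H x := ereal_sup (range (h ^~ x)).
have HE : H = (fun x => esups (h ^~ x) 0%N).
  apply/funext => x; rewrite /H /esups; congr ereal_sup.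
  by apply/seteqP; split => _ [n _ <-]; exists n.
have mH : measurable_fun setT H by rewrite HE; exact: measurable_fun_esups.
have hH n x : h n x <= H x by apply: ereal_sup_ubound; exists n.
have H01 x : 0 <= H x <= 1.
  rewrite (le_trans (h0 0%N x))//=.
  by apply: ge_ereal_sup => _ [n _ <-].
exists H, (fun x => \sum_(n <oo) g n x); split => //.
- move=> x [n _ Anx]; apply/eqP; rewrite eq_le (andP (H01 x)).2/=.
  by have [_ _ /(_ x Anx) <- _ _] := hg n.
- split.
  + by apply: ge0_emeasurable_sum => // n _; have [] := ug n.
  + by move=> x; exact: nneseries_ge0.
  + move=> l gamma cg.
    rewrite integral_nneseries//; last by move=> n; apply: measurable_curve => //; have [] := ug n.
    have Hfin x : H x \is a fin_num.
      have /andP[? ?] := H01 x; by rewrite ge0_fin_numE// (@le_lt_trans _ _ 1)// ltry.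
    have key x y : (forall n, `|h n x - h n y| <=
          \int[lebesgue_measure]_(t in `[0%R, l]) g n (gamma t)) ->
        H x <= H y + \sum_(n <oo) \int[lebesgue_measure]_(t in `[0%R, l]) g n (gamma t).
      move=> hxy; apply: ge_ereal_sup => _ [n _ <-].
      have i0 k : 0 <= \int[lebesgue_measure]_(t in `[0%R, l]) g k (gamma t) by exact: integral_ge0.
      rewrite -(gee0_abs (h0 n x)); apply: le_trans (lee_abs_shift _ (h n y)) _.
      apply: leeD; first by rewrite gee0_abs.
      apply: le_trans (hxy n) _.
      apply: le_trans (nneseries_lim_ge n.+1 _); last by [].
      by rewrite big_nat_recr//= leeDr// sume_ge0.
    have ugc n : `|h n (gamma 0%R) - h n (gamma l)| <=
        \int[lebesgue_measure]_(t in `[0%R, l]) g n (gamma t).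
      by have [_ _] := ug n; exact.
    apply: lee_dist => //; apply: key => n //.
    rewrite (_ : `|_ - _| = `|h n (gamma 0%R) - h n (gamma l)|)//.
    by case: (h n (gamma 0%R)) (h n (gamma l)) => [x| |] [y| |]//=; rewrite distrC.
- split; last first.
    apply: norm_series_le => // n; by have [_ _ _ _ []] := hg n.
  apply: le_trans (norm_series_le b0 mh h0 _); last first.
    by move=> n; have [_ _ _ _ []] := hg n.
  apply: ge0_norm_le => //.
  + exact: ge0_emeasurable_sum.
  + by move=> x; have /andP[] := H01 x.
  + move=> x; apply: ge_ereal_sup => _ [n _ <-].
    apply: le_trans (nneseries_lim_ge n.+1 _); last by [].
    by rewrite big_nat_recr//= leeDr// sume_ge0.
Qed.

End FunctionLattice.

(** * Operations on lower semicontinuous functions *)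

Section Semicontinuity.
Context {R : realType} {X : topologicalType}.
Implicit Types f g : X -> \bar R.
Local Open Scope ereal_scope.

Lemma lsc_add f g : (forall x, 0 <= f x) -> (forall x, 0 <= g x) ->
  lower_semicontinuous f -> lower_semicontinuous g ->
  lower_semicontinuous (fun x => f x + g x).
Proof.
move=> f0 g0 lf lg x r rfg.
have [r1 [r2 [rE r1f r2g]]] : exists r1 r2 : R,
    [/\ r = (r1 + r2)%R, r1%:E < f x & r2%:E < g x].
  move: rfg (f0 x) (g0 x); case: (f x) (g x) => [s| |] [t| |] //.
  - rewrite -EFinD lte_fin => rst _ _.
    exists (s - (s + t - r) / 2)%R, (t - (s + t - r) / 2)%R.
    by rewrite !lte_fin; split; lra.
  - move=> _ _ _; exists (s - 1)%R, (r - (s - 1))%R.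
    by rewrite lte_fin ltry; split => //; lra.
  - move=> _ _ _; exists (r - (t - 1))%R, (t - 1)%R.
    by rewrite lte_fin ltry; split => //; lra.
  - by move=> _ _ _; exists r, 0%R; rewrite !ltry addr0.
have [V Vx Vf] := lf _ _ r1f; have [V' V'x Vg] := lg _ _ r2g.
exists (V `&` V'); first exact: filterI.
by move=> y [Vy V'y]; rewrite rE EFinD lteD ?Vf ?Vg.
Qed.

Lemma lsc_scale (a : R) f : (0 < a)%R -> lower_semicontinuous f ->
  lower_semicontinuous (fun x => a%:E * f x).
Proof.
move=> a0 lf x r; rewrite -lte_pdivrMl// -EFinM => /lf[V Vx Vf].
by exists V => // y /Vf; rewrite -lte_pdivrMl// -EFinM.
Qed.

End Semicontinuity.

(** * Open supersets of small capacity *)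

Section OuterCapacity.
Context {R : realType} {d : measure_display} {P : metricMeasurableType d R}.
Variables (mu : {measure set P -> \bar R}) (c : R) (N : (P -> \bar R) -> \bar R).
Hypotheses (hP : metric_measure_space mu)
  (hX : quasi_banach_function_lattice mu c N).
Implicit Types (u v w g h : P -> \bar R).
Local Open Scope ereal_scope.

(* A weak form of the Vitali-Caratheodory property: up to the factor [c], which
   is lost when it is derived from absolute continuity. *)
Definition has_lsc_majorants := forall u (b : R),
  measurable_fun setT u -> (forall x, 0 <= u x) -> N u < b%:E ->
  exists v, [/\ lower_semicontinuous v, forall x, u x <= v x & N v <= (c * b)%:E].

Lemma open_lt_lsc v (t : R) : lower_semicontinuous v -> open [set x | t%:E < v x].
Proof. by move=> /lower_semicontinuousP; exact. Qed.

(* A path from a point of E `&` ball x0 r to the complement of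
   W = V `&` ball x0 (2 r) leaves either V = {w > 1/2}, so that h drops from 1 to
   at most 1/2 and the term 2 v of rho costs at least 1, or the ball, so that it
   has length at least r in V, where the term (2 / r) w of rho is at least 1 / r.
   Hence path_fun W rho = 1 on E `&` ball x0 r. *)
Lemma cap_le_open_superset (E K : set P) (x0 : P) (r b : R) :
  has_lsc_majorants -> compact K -> closed K -> ball x0 (2 * r)%R `<=` K ->
  (0 < r)%R -> (0 < b)%R -> cap_le N E b ->
  exists U, [/\ open U, E `&` ball x0 r `<=` U &
    cap_le N U (8 * c ^+ 2 * (1 + r^-1) * b)].
Proof.
move=> maj cK clK BK r0 b0 [h [g [mh h01 hE ug [hb gb]]]].
have c1 : (1 <= c)%R := qbfl_modulus_ge1 hX.
have ri0 : (0 < r^-1)%R by rewrite invr_gt0.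
(* [has_lsc_majorants] asks for a strict bound, whence 2 b; the majorants then have quasi-norm at
   most 2 c b. *)
have bb : b%:E < (2 * b)%:E by rewrite lte_fin; lra.
have [bg g0 ugg] := ug; have mg := borel_measurable hP bg.
have [w [lw hw wb]] := maj h _ mh (fun x => proj1 (andP (h01 x))) (le_lt_trans hb bb).
have [v [lv gv vb]] := maj g _ mg g0 (le_lt_trans gb bb).
have w0 x : 0 <= w x by apply: le_trans (hw x); have /andP[] := h01 x.
have v0 x : 0 <= v x by apply: le_trans (gv x).
have mw := lsc_measurable hP lw; have mv := lsc_measurable hP lv.
pose V := [set x | (2^-1)%:E < w x].
pose W := V `&` ball x0 (2 * r)%R.
have oW : open W.
  by apply: openI; [exact: open_lt_lsc|exact: open_ball_metric].
have WK : W `<=` K by move=> x [_ /BK].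
pose rho x := 2%:E * v x + (2 * r^-1)%:E * w x.
have ri20 : (0 < 2 * r^-1)%R by rewrite mulr_gt0.
have v20 x : 0 <= 2%:E * v x by rewrite mule_ge0.
have w20 x : 0 <= (2 * r^-1)%:E * w x by rewrite mule_ge0// lee_fin ltW.
have lrho : lower_semicontinuous rho by apply: lsc_add => //; exact: lsc_scale.
have rho0 x : 0 <= rho x by exact: adde_ge0.
have rhoW x : W x -> (r^-1)%:E <= rho x.
  move=> [Vx _]; apply: (@le_trans _ _ ((2 * r^-1)%:E * w x)); last by rewrite leeDr.
  apply: (@le_trans _ _ ((2 * r^-1)%:E * (2^-1)%:E)).
    by rewrite -EFinM lee_fin mulrAC divff ?mul1r.
  by apply: lee_wpmul2l; [rewrite lee_fin ltW|exact: ltW].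
have brho := lsc_borel_fun lrho.
pose u := path_fun W rho.
have lu : lower_semicontinuous u := path_fun_lsc oW lrho rho0 cK clK WK ri0 rhoW.
have mu_ := lsc_measurable hP lu.
have u0 x : 0 <= u x := path_fun_ge0 W rho0 x.
(* The majorant [w] also controls [u] itself: u <= 1 <= 2 w on [W], where w > 1/2, and u = 0
   elsewhere. *)
have ub : N u <= (2 * (c * (2 * b)))%:E.
  apply: (@le_trans _ _ (N (fun x => 2%:E * w x))); last exact: (norm_scale_le hX).
  apply: (ge0_norm_le hX) => //; first exact: emeasurable_funM.
  move=> x; have [Wx|Wx] := pselect (W x); last first.
    by rewrite /u path_fun_out// mule_ge0.
  apply: le_trans (path_fun_le1 _ _ _) _.
  rewrite (_ : 1 = 2%:E * (2^-1)%:E); last by rewrite -EFinM divff.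
  by rewrite lee_wpmul2l// ltW//; case: Wx.
have rb : N rho <= (c * (2 * (c * (2 * b)) + 2 * r^-1 * (c * (2 * b))))%:E.
  apply: (norm_add_le hX); try exact: emeasurable_funM.
    exact: (norm_scale_le hX).
  by apply: (norm_scale_le hX) => //; exact: ltW.
exists [set x | (2^-1)%:E < u x]; split; first exact: open_lt_lsc.
- move=> x [Ex xB] /=; suff -> : u x = 1 by rewrite lte_fin; lra.
  apply: path_fun_eq1 => gamma l gamma1 l0 gx Wl.
  have xW : W (gamma 0%R).
    rewrite gx; split; first by apply: lt_le_trans (hw x); rewrite hE// lte_fin; lra.
    by move: xB; rewrite !ballEmdist/=; lra.
  have [l' [/andP[l'0 l'l] Wl' Wt]] := first_exit oW gamma1 l0 xW Wl.
  apply: le_trans (path_cost_subset lrho rho0 gamma1 l'l).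
  have [Vl|Vl] := pselect (V (gamma l')); last first.
    have hl' : h (gamma l') <= (2^-1)%:E.
      by apply: le_trans (hw _) _; rewrite leNgt; apply/negP.
    have neq : gamma 0%R <> gamma l'.
      by move=> eq; move: hl'; rewrite -eq gx hE// lee_fin; lra.
    have := upper_gradient_lip1 ug gamma1 (ltW l'0) neq.
    rewrite gx hE// => hg.
    have {hg} : (2^-1)%:E <= \int[lebesgue_measure]_(t in `[0%R, l']) g (gamma t).
      apply: le_trans hg; apply: le_trans (lee_abs _).
      have : h (gamma l') \is a fin_num.
        have /andP[? ?] := h01 (gamma l').
        by rewrite ge0_fin_numE// (le_lt_trans hl')// ltry.
      by case: (h (gamma l')) hl' => [s| |]//; rewrite -EFinD !lee_fin; lra.
    rewrite -(@lee_pmul2l _ 2%:E)// ?lte_fin// -EFinM divff// => /le_trans; apply.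
    rewrite -ge0_integralZl_EFin//; last exact: measurable_path.
    apply: ge0_le_integral => //.
    + by move=> t _; rewrite mule_ge0.
    + by apply: measurable_funeM; exact: measurable_path.
    + exact: measurable_path.
    + by move=> t _; rewrite /rho (@le_trans _ _ (2%:E * v (gamma t)))// ?lee_wpmul2l// leeDl.
  have Bl : (2 * r <= mdist x0 (gamma l'))%R.
    rewrite leNgt; apply/negP => Bl; apply: Wl'; split => //.
    by rewrite ballEmdist.
  have rl' : (r <= l')%R.
    have := lip1_mdist gamma1 (ltW l'0); rewrite gx.
    have := metric_triangle x0 x (gamma l').
    by move: xB; rewrite ballEmdist/=; lra.
  apply: le_trans (path_cost_ge_length lrho ri0 rhoW gamma1 (ltW l'0) Wt).
  by rewrite lee_fin mulrC ler_pdivlMr// mul1r.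
- apply: (@cap_leS _ _ _ N _ [set x | (2^-1)%:E <= `|u x|]) (lexx _) _.
    by move=> x /= ux; rewrite gee0_abs// ltW.
  have ugu : upper_gradient u rho := path_fun_upper_gradient W brho rho0.
  (* The bound on [N rho] is 4 c^2 (1 + 1/r) b; the weak type estimate at level 1/2 doubles it,
     which explains the constant 8. *)
  have e1 : (2^-1 * (8 * c ^+ 2 * (1 + r^-1) * b) =
      c * (2 * (c * (2 * b)) + 2 * r^-1 * (c * (2 * b))))%R by field; rewrite gt_eqF.
  apply: (cap_le_weak hP hX mu_ ugu) => //.
    apply: le_trans ub _; rewrite e1 lee_fin.
    have h1 : (0 <= (c - 1) * (c * b))%R by rewrite mulr_ge0 ?subr_ge0// mulr_ge0; lra.
    have h2 : (0 <= r^-1 * (c * (c * b)))%R by rewrite !mulr_ge0//; lra.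
    move: (r^-1)%R h2 => q h2; nra.
  by rewrite e1.
Qed.

End OuterCapacity.

(** * Lower semicontinuous majorants *)

Section LscMajorants.
Context {R : realType} {d : measure_display} {P : metricMeasurableType d R}.
Variables (mu : {measure set P -> \bar R}) (c : R) (N : (P -> \bar R) -> \bar R).
Hypotheses (hP : metric_measure_space mu)
  (hX : quasi_banach_function_lattice mu c N).
Local Open Scope ereal_scope.

Let c1 : (1 <= c)%R := qbfl_modulus_ge1 hX.
Let c0 : (0 < c)%R := lt_le_trans ltr01 c1.

Lemma vitali_caratheodory_majorants : vitali_caratheodory N ->
  has_lsc_majorants c N.
Proof.
move=> vc u b mu_ u0 ub.
have b0 : (0 < b)%R by rewrite -lte_fin (le_lt_trans _ ub)// (qbfl_ge0 hX).
move: ub; rewrite vc// => /ereal_inf_lt[_ [v [uv lv] <-] vb].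
exists v; split => //; first by move=> x; rewrite -(gee0_abs (u0 x)).
by apply: le_trans (ltW vb) _; rewrite lee_fin ler_peMl// ltW.
Qed.

Definition ind (S : set P) : P -> \bar R := fun x => (\1_S x)%:E.

Lemma ind_ge0 S x : 0 <= ind S x.
Proof. by rewrite lee_fin. Qed.

Lemma measurable_ind S : measurable S -> measurable_fun setT (ind S).
Proof. by move=> mS; apply/measurable_EFinP; exact: measurable_indic. Qed.

Lemma le_ind S T x : S `<=` T -> ind S x <= ind T x.
Proof.
move=> ST; rewrite lee_fin !indicE ler_nat; case: (boolP (x \in S)) => //.
by rewrite !inE => /ST xT; rewrite mem_set.
Qed.

Lemma norm_ind_le S T : measurable S -> measurable T -> S `<=` T ->
  N (ind S) <= N (ind T).
Proof.
move=> mS mT ST; apply: (ge0_norm_le hX); try exact: measurable_ind.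
  exact: ind_ge0.
by move=> x; exact: le_ind.
Qed.

Lemma norm_ind_null S : measurable S -> mu S = 0 -> N (ind S) = 0.
Proof.
move=> mS S0; apply/(qbfl_eq0 hX); first exact: measurable_ind.
exists S; split => // x /= nx; apply: contrapT => Sx; apply: nx.
by rewrite /ind indicE memNset.
Qed.

Lemma indU_le S T x : ind (S `|` T) x <= ind S x + ind T x.
Proof.
rewrite -EFinD lee_fin !indicE in_setU; case: (x \in S); case: (x \in T);
  rewrite /= -?natrD ?ler_nat//.
Qed.

Lemma norm_indU_le S T (a b : R) : measurable S -> measurable T ->
  N (ind S) <= a%:E -> N (ind T) <= b%:E -> N (ind (S `|` T)) <= (c * (a + b))%:E.
Proof.
move=> mS mT Sa Tb; apply: le_trans (norm_add_le hX _ _ Sa Tb); last 2 first.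
- exact: measurable_ind.
- exact: measurable_ind.
apply: (ge0_norm_le hX).
- by apply: measurable_ind; exact: measurableU.
- by apply: emeasurable_funD; exact: measurable_ind.
- exact: ind_ge0.
- by move=> x; exact: indU_le.
Qed.

Lemma norm_ind_bigcup_le (S : nat -> set P) (b : R) : (0 <= b)%R ->
  (forall n, measurable (S n)) ->
  (forall n, N (ind (S n)) <= (b / (2 * c) ^+ n.+1)%:E) ->
  N (ind (\bigcup_n S n)) <= b%:E.
Proof.
move=> b0 mS Sb; apply: le_trans (norm_series_le hX b0 _ _ Sb).
- apply: (ge0_norm_le hX).
  + by apply: measurable_ind; exact: bigcupT_measurable.
  + by apply: ge0_emeasurable_sum => [n x _ _|n _]; [exact: ind_ge0|exact: measurable_ind].
  + exact: ind_ge0.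
  + move=> x; have [[n _ Snx]|nS] := pselect ((\bigcup_n S n) x); last first.
      by rewrite {1}/ind indicE memNset// nneseries_ge0// => n _ _; exact: ind_ge0.
    apply: (@le_trans _ _ (ind (S n) x)); first by rewrite /ind !indicE !mem_set//; exists n.
    apply: le_trans (nneseries_lim_ge n.+1 _); last by move=> *; exact: ind_ge0.
    by rewrite big_nat_recr//= leeDr// sume_ge0// => *; exact: ind_ge0.
- by move=> n; exact: measurable_ind.
- by move=> n x; exact: ind_ge0.
Qed.

Hypothesis bac : bounded_sets_absolutely_continuous N mu.

Lemma norm_ind_decreasing (B : set P) (E : nat -> set P) (e : R) :
  measurable B -> bounded_subset B -> (forall n, measurable (E n)) ->
  (forall n, E n.+1 `<=` E n) -> \bigcap_n E n = set0 -> (0 < e)%R ->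
  exists n, N (ind (E n `&` B)) < e%:E.
Proof.
move=> mB bB mE dE E0 e0.
have [_ /(_ E mE dE)] := bac mB bB; rewrite E0 measure0 => /(_ erefl) h.
have nb : nbhs (0 : \bar R) [set y | y < e%:E].
  by apply: open_nbhs_nbhs; split; [exact: open_ereal_lt_ereal|rewrite /= lte_fin].
have [n _ nP] := h _ nb; exists n; have := nP n (leqnn n).
congr (N _ < _); apply/funext => x.
by rewrite /ind !indicE in_setI -EFinM -natrM mulnb andbC.
Qed.

(* Regularity of Borel sets, with the quasi-norm of the indicator in the role of
   the measure: absolute continuity is continuity from above at the empty set. *)
Definition approximable (B D : set P) := forall e : R, (0 < e)%R ->
  exists F U, [/\ closed F, open U, F `<=` D, D `<=` U &
    N (ind ((U `\` F) `&` B)) < e%:E].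

Lemma open_measurable_space (U : set P) : open U -> measurable U.
Proof. by move=> oU; apply: mms_borel hP _ _; exact: open_borel_set. Qed.

Lemma closed_measurable_space (F : set P) : closed F -> measurable F.
Proof.
move=> cF; rewrite -(setCK F); apply: measurableC.
by apply: open_measurable_space; exact: closed_openC.
Qed.

Section approximation.
Variable B : set P.
Hypotheses (mB : measurable B) (bB : bounded_subset B).

Lemma open_approximable (D : set P) : open D -> approximable B D.
Proof.
move=> oD e e0.
(* [G n] is the neighbourhood of radius 1 / (n + 1) of the complement. As [D] is open, its part in
   [G n] decreases to the empty set. *)
pose G n := \bigcup_(y in ~` D) ball y (n.+1%:R^-1 : R)%R.
have oG n : open (G n) by apply: bigcup_open => y _; exact: open_ball_metric.
have [||||n ne] := @norm_ind_decreasing B (fun n => D `&` G n) e mB bB.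
- by move=> n; apply: measurableI; exact: open_measurable_space.
- move=> n x [Dx [y Dy yx]]; split => //; exists y => //.
  by apply: le_ball yx; rewrite lef_pV2 ?posrE// ler_nat.
- apply/seteqP; split => // x h.
  have [Dx _] := h 0%N Logic.I.
  have /nbhs_ballP[r /= r0 rD] : nbhs x D by exact: open_nbhs_nbhs.
  have [n _ nP] := near_infty_natSinv_lt (PosNum r0).
  have [_ [y Dy yx]] := h n Logic.I; apply: Dy; apply: rD; apply: ball_sym.
  by apply: le_ball yx; apply: ltW; apply: (nP n) => /=.
- by [].
exists (~` G n), D; split => //; first exact: open_closedC.
- move=> x Gx; apply: contrapT => Dx; apply: Gx; exists x => //.
  by apply: ballxx; rewrite invr_gt0.
- by rewrite setDE setCK.
Qed.

Lemma approximable_setC D : approximable B D -> approximable B (~` D).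
Proof.
move=> aD e e0; have [F [U [cF oU FD DU UF]]] := aD e e0.
exists (~` U), (~` F); split.
- exact: open_closedC.
- exact: closed_openC.
- exact: subsetC.
- exact: subsetC.
- by have -> : ~` F `\` ~` U = U `\` F by rewrite !setDE setCK setIC.
Qed.

(** The union of the open sets serves as it is, but that of the closed sets need not be closed: a
    finite union [H n] replaces it, with a remainder that is small by absolute continuity. *)
Lemma approximable_bigcup (D : nat -> set P) :
  (forall n, approximable B (D n)) -> approximable B (\bigcup_n D n).
Proof.
move=> aD e e0.
(* The excess splits into the union of the [U k] minus [F k] and the remainder beyond [H n], each of
   quasi-norm at most e'; together they contribute c (e' + e') = e / 2. *)
pose e' := (e / (4 * c))%R.
have e'0 : (0 < e')%R by rewrite divr_gt0// mulr_gt0.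
have ck n : (0 < e' / (2 * c) ^+ n.+1)%R.
  by rewrite divr_gt0// exprn_gt0// mulr_gt0.
have /choice[F /choice[U FU]] : forall n, exists F U, [/\ closed F, open U,
    F `<=` D n, D n `<=` U & N (ind ((U `\` F) `&` B)) < (e' / (2 * c) ^+ n.+1)%:E].
  by move=> n; exact: aD.
have mF n : measurable (F n) by apply: closed_measurable_space; have [] := FU n.
have mU n : measurable (U n) by apply: open_measurable_space; have [] := FU n.
pose H n := \big[setU/set0]_(k < n) F k.
have cH n : closed (H n).
  by apply: closed_bigsetU => k _; have [] := FU k.
have mH n : measurable (H n) by exact: closed_measurable_space.
have mFoo : measurable (\bigcup_n F n) by exact: bigcupT_measurable.
have mUoo : measurable (\bigcup_n U n) by exact: bigcupT_measurable.
have [||||n ne] := @norm_ind_decreasing B (fun n => \bigcup_n F n `\` H n) e' mB bB.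
- by move=> n; exact: measurableD.
- move=> n; apply: setDS; rewrite /H big_ord_recr/=; exact: subsetUl.
- apply/seteqP; split => // x h; have [[n _ Fnx] _] := h 0%N Logic.I.
  have [_] := h n.+1 Logic.I; apply.
  by rewrite /H big_ord_recr/=; right.
- exact: e'0.
exists (H n), (\bigcup_n U n); split => //.
- by apply: bigcup_open => k _; have [] := FU k.
- move=> x; rewrite /H -bigcup_mkord => -[k _ Fx]; exists k => //.
  by have [_ _ + _ _] := FU k; apply.
- by apply: subset_bigcup => k _; have [] := FU k.
have mUF : measurable (\bigcup_k ((U k `\` F k) `&` B)).
  by apply: bigcupT_measurable => k; apply: measurableI => //; exact: measurableD.
apply: (@le_lt_trans _ _ (c * (e' + e'))%:E); last first.
  rewrite lte_fin /e' -mulr2n -mulr_natl.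
  by rewrite (_ : c * _ = e / 2)%R; [lra|field; rewrite gt_eqF].
apply: le_trans (norm_indU_le mUF _ _ (ltW ne)); last 2 first.
- by apply: measurableI => //; exact: measurableD.
- apply: norm_ind_bigcup_le; first exact: ltW.
  + by move=> k; apply: measurableI => //; exact: measurableD.
  + by move=> k; have [_ _ _ _ /ltW] := FU k.
apply: norm_ind_le.
- by apply: measurableI => //; exact: measurableD.
- by apply: measurableU => //; apply: measurableI => //; exact: measurableD.
move=> x [[[k _ Ux] Hx] Bx].
have [Fx|Fx] := pselect ((\bigcup_n F n) x); first by right.
by left; exists k => //; split => //; split => // Fkx; apply: Fx; exists k.
Qed.

Lemma borel_approximable (D : set P) : borel_set D -> approximable B D.
Proof.
apply: smallest_sub; last by move=> U; exact: open_approximable.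
split.
- by apply: open_approximable; exact: open0.
- by move=> A aA; rewrite setTD; exact: approximable_setC.
- exact: approximable_bigcup.
Qed.

(** A Borel hull [D] of [A] exceeds it by a null set, invisible to [N]; [mu B < +oo] makes the
    measures of [D] and [A] finite, so that they can be subtracted. Intersecting with the open set
    [B] confines the excess to where [approximable] controls it. *)
Lemma measurable_outer_approximation (A : set P) (e : R) :
  open B -> mu B < +oo -> measurable A -> A `<=` B -> (0 < e)%R ->
  exists U, [/\ open U, A `<=` U & N (ind (U `\` A)) <= e%:E].
Proof.
move=> oB Boo mA AB e0.
have [D [bD AD DA]] := mms_borel_regular hP mA.
have mD := mms_borel hP bD.
have ec : (0 < e / c)%R by rewrite divr_gt0.
have [F [U [cF oU FD DU UF]]] := borel_approximable bD ec.
exists (U `&` B); split; first exact: openI.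
  by move=> x Ax; split; [exact/DU/AD|exact: AB].
have mU := open_measurable_space oU; have mF := closed_measurable_space cF.
have mDA : measurable (D `&` B `\` A) by apply: measurableD => //; exact: measurableI.
have nDA : N (ind (D `&` B `\` A)) = 0.
  apply: norm_ind_null => //; apply/eqP; rewrite eq_le measure_ge0 andbT.
  apply: (@le_trans _ _ (mu (D `\` A))).
    by apply: le_measure; rewrite ?inE//; [exact: measurableD|move=> x [[]]].
  have Aoo : mu A < +oo by apply: le_lt_trans Boo; apply: le_measure; rewrite ?inE.
  have Doo : mu D < +oo by rewrite DA.
  rewrite (_ : mu (D `\` A) = mu D - mu (D `&` A)); last exact: measureD.
  by rewrite setIidr// DA subee// ge0_fin_numE.
apply: (@le_trans _ _ (c * (e / c + 0))%:E); last first.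
  by rewrite addr0 mulrC divfK// gt_eqF.
apply: le_trans (norm_indU_le _ mDA (ltW UF) _); last 2 first.
- by apply: measurableI => //; exact: measurableD.
- by rewrite nDA.
apply: norm_ind_le.
- by apply: measurableD => //; exact: measurableI.
- by apply: measurableU => //; apply: measurableI => //; exact: measurableD.
move=> x [[Ux Bx] Ax]; have [Dx|Dx] := pselect (D x); first by right.
by left; split => //; split => // /FD.
Qed.

End approximation.

(* Each superlevel set [A j] = {u > q j} inside a ball has an open superset [U j]
   with little excess, and v = sup_j q_j 1_(U j) is at least u, and at most
   u + sum_j q_j 1_(U j \ A j). *)
Lemma bounded_absolutely_continuous_majorants : has_lsc_majorants c N.
Proof.
move=> u b mu_ u0 ub.
have Nu0 : 0 <= N u by exact: (qbfl_ge0 hX).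
have Nfin : N u \is a fin_num by rewrite ge0_fin_numE// (lt_le_trans ub)// leey.
pose a := (fine (N u)); have NE : N u = a%:E by rewrite fineK.
(* The gap b - a is spent on the excess series; the quasi-triangle inequality then gives c (a + (b -
   a)) = c b. *)
have ab : (0 < b - a)%R by rewrite subr_gt0 -lte_fin -NE.
pose x0 : P := point.
pose idx (j : nat) : rat * nat := odflt (0, 0%N)%R (unpickle j).
pose q j : R := `|ratr (idx j).1|%R.
pose B n : set P := ball x0 n.+1%:R.
pose A j := [set x | (q j)%:E < u x] `&` B (idx j).2.
have q0 j : (0 <= q j)%R by rewrite /q.
have mB n : measurable (B n) by exact: open_measurable_space (open_ball_metric _ _).
have mA j : measurable (A j).
  apply: measurableI => //; rewrite -[X in measurable X]setTI.
  by apply: emeasurable_fun_o_infty.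
(* Division by [q j + 1] absorbs the coefficient [q j] of the indicator, and is legitimate when
   [q j] is 0. *)
have ck j : (0 < (b - a) / (2 * c) ^+ j.+1 / (q j + 1))%R.
  rewrite divr_gt0//; last by have := q0 j; lra.
  by rewrite divr_gt0// exprn_gt0// mulr_gt0.
have /choice[U UP] : forall j, exists U, [/\ open U, A j `<=` U &
    N (ind (U `\` A j)) <= ((b - a) / (2 * c) ^+ j.+1 / (q j + 1))%:E].
  move=> j; apply: (@measurable_outer_approximation (B (idx j).2)) => //.
  - by exists x0, (idx j).2.+1%:R.
  - exact: open_ball_metric.
  - by have [] := mms_ball hP x0 (ltr0Sn R (idx j).2).
  - exact: subIsetr.
have mU j : measurable (U j) by apply: open_measurable_space; have [] := UP j.
pose v x := ereal_sup (range (fun j => (q j)%:E * ind (U j) x)).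
have v0 x : 0 <= v x.
  apply: (@le_trans _ _ ((q 0%N)%:E * ind (U 0%N) x)).
    by apply: mule_ge0; [rewrite lee_fin|exact: ind_ge0].
  by apply: ereal_sup_ubound; exists 0%N.
have lv : lower_semicontinuous v.
  move=> x r /ereal_sup_gt[_ [j _ <-] rj].
  have [Ux|Ux] := pselect (U j x).
    exists (U j); first by apply: open_nbhs_nbhs; split => //; have [] := UP j.
    move=> y Uy; apply: lt_le_trans rj _; apply: ereal_sup_ubound.
    by exists j => //; rewrite /ind !indicE !mem_set.
  exists setT; first exact: filterT.
  move=> y _; apply: lt_le_trans (v0 y); move: rj.
  by rewrite /ind indicE memNset// mule0.
have mv := lsc_measurable hP lv.
exists v; split => //.
- move=> x; apply: lee_fin_lb => r rx.
  have [r0|r0] := ltP r 0%R; first by apply: le_trans (v0 x); rewrite lee_fin ltW.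
  have [s rs sx] : exists2 s : R, (r < s)%R & s%:E < u x.
    move: rx; case: (u x) => [t| |]//; rewrite ?lte_fin => rt.
      by exists ((r + t) / 2)%R; rewrite ?lte_fin; lra.
    by exists (r + 1)%R; rewrite ?ltry//; lra.
  have [p] := rat_in_itvoo rs; rewrite in_itv/= => /andP[rp ps].
  pose n := Num.truncn (mdist x0 x).
  have xB : B n x by rewrite /B ballEmdist/=; exact: truncnS_gt.
  pose j := pickle (p, n).
  have jE : idx j = (p, n) by rewrite /idx pickleK.
  have qE : q j = ratr p by rewrite /q jE ger0_norm// ltW// (le_lt_trans r0).
  have Ux : U j x.
    have [_ + _] := UP j; apply; split; last by rewrite jE.
    by rewrite /= qE (lt_trans _ sx)// lte_fin.
  apply: (@le_trans _ _ ((q j)%:E * ind (U j) x)).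
    by rewrite /ind indicE mem_set// mule1 lee_fin qE ltW.
  by apply: ereal_sup_ubound; exists j.
pose w j x := (q j)%:E * ind (U j `\` A j) x.
have mUA j : measurable (U j `\` A j) by exact: measurableD.
have mw j : measurable_fun setT (w j).
  by apply: measurable_funeM; exact: measurable_ind.
have w0 j x : 0 <= w j x by apply: mule_ge0; [rewrite lee_fin|exact: ind_ge0].
have wb : N (fun x => \sum_(j <oo) w j x) <= (b - a)%:E.
  apply: (norm_series_le hX) => //; first exact: ltW.
  move=> j; have [_ _ UA] := UP j.
  apply: le_trans (norm_scale_le hX (measurable_ind (mUA j)) (q0 j) UA) _.
  rewrite lee_fin mulrCA ger_pMr; last first.
    by rewrite divr_gt0// exprn_gt0// mulr_gt0.
  by rewrite ler_pdivrMr ?mul1r; have := q0 j; lra.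
have msw : measurable_fun setT (fun x => \sum_(j <oo) w j x).
  exact: ge0_emeasurable_sum.
have aN : N u <= a%:E by rewrite NE.
have := norm_add_le hX mu_ msw aN wb; rewrite addrC subrK; apply: le_trans.
apply: (ge0_norm_le hX) => //.
  exact: emeasurable_funD.
move=> x; apply: ge_ereal_sup => _ [j _ <-].
have s0 : 0 <= \sum_(j <oo) w j x by exact: nneseries_ge0.
have [Ux|Ux] := pselect (U j x); last first.
  by rewrite /ind indicE memNset// mule0 adde_ge0.
have [Ax|Ax] := pselect (A j x).
  rewrite /ind indicE mem_set// mule1; case: Ax => /ltW qu _.
  by apply: le_trans qu _; rewrite leeDl.
apply: (@le_trans _ _ (w j x)).
  by rewrite /w /ind !indicE !mem_set.
apply: le_trans (_ : \sum_(j <oo) w j x <= _); last by rewrite leeDr.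
apply: le_trans (nneseries_lim_ge j.+1 _); last by [].
by rewrite big_nat_recr//= leeDr// sume_ge0.
Qed.

End LscMajorants.

(** * Countable covers *)

Lemma countable_enum (T : pointedType) (A : set T) : countable A ->
  exists f : nat -> T, forall x, A x -> exists n, f n = x.
Proof.
move=> /countable_injP[g ginj].
have /choice[f fP] : forall n : nat, exists x : T,
    (exists2 y, A y & g y = n) -> A x /\ g x = n.
  move=> n; have [[y Ay gy]|no] := pselect (exists2 y, A y & g y = n).
    by exists y.
  by exists point => /no.
exists f => x Ax; exists (g x).
have [Af gf] := fP (g x) (ex_intro2 _ _ x Ax erefl).
by apply: ginj => //; rewrite inE.
Qed.

Section CountableCover.
Context {R : realType} {d : measure_display} {P : metricMeasurableType d R}.
Variables (mu : {measure set P -> \bar R}) (hP : metric_measure_space mu).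

(** Only finitely many disjoint balls of measure above 1 / (k + 1) can have centres in a given ball,
    since they fit in a larger ball of finite measure; as every ball has positive measure, countably
    many such classes exhaust [S]. *)
Lemma countable_disjoint_balls (e : R) (S : set P) : 0 < e ->
  trivIset S (fun x => ball x e) -> countable S.
Proof.
move=> e0 tS.
pose x0 : P := point.
pose T (m k : nat) := [set s | [/\ S s, ball x0 m%:R s &
  ((k.+1%:R^-1)%:E < mu (ball s e))%E]].
have mball (x : P) (r : R) : measurable (ball x r).
  exact: (open_measurable_space hP (open_ball_metric _ _)).
suff fT m k : finite_set (T m k).
  apply: (@sub_countable _ _ _ (\bigcup_(mk in [set: nat * nat]) T mk.1 mk.2)); last first.
    by apply: bigcup_countable => // mk _; exact: finite_set_countable.
  apply: subset_card_le => s Ss.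
  have [mu0 muoo] := mms_ball hP s e0.
  have fin : mu (ball s e) \is a fin_num by rewrite ge0_fin_numE.
  have f0 : 0 < fine (mu (ball s e)) by rewrite fine_gt0// mu0.
  have [k _ kP] := near_infty_natSinv_lt (PosNum f0).
  exists ((Num.truncn (mdist x0 s)).+1, k) => //; split => //=.
    by rewrite ballEmdist/=; exact: truncnS_gt.
  by rewrite -(fineK fin) lte_fin; apply: (kP k) => /=.
apply: contrapT => /infiniteP/ppcard_leP[f].
have fTn n : T m k (f n) by exact: funS.
have finj : injective f by move=> i j ij; apply: ('inj_f (in_setT i) (in_setT j) ij).
have tf : trivIset setT (fun n => ball (f n) e).
  move=> i j _ _ ij; apply: finj; apply: tS => //; first by have [] := fTn i.
  by have [] := fTn j.
have sub : \bigcup_n ball (f n) e `<=` ball x0 (m%:R + e).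
  move=> y [n _]; have [_ + _] := fTn n; rewrite !ballEmdist/=.
  by have := metric_triangle x0 (f n) y; lra.
have me0 : 0 < m%:R + e by rewrite ltr_wpDl.
have [_ Boo] := mms_ball hP x0 me0.
have mU : measurable (\bigcup_n ball (f n) e) by exact: bigcupT_measurable.
have : (mu (\bigcup_n ball (f n) e) < +oo)%E.
  by apply: le_lt_trans Boo; apply: le_measure; rewrite ?inE//; exact: mball.
rewrite measure_semi_bigcup//; apply/negP; rewrite -leNgt leye_eq; apply/eqP.
apply/eqyP => A A0.
pose n := Num.truncn (A * k.+1%:R).
apply: le_trans (nneseries_lim_ge n.+1 _); last by move=> *; exact: measure_ge0.
apply: (@le_trans _ _ (\sum_(0 <= i < n.+1) (k.+1%:R^-1)%:E)%E).
  rewrite sumEFin lee_fin sumr_const_nat subn0 -[leRHS]mulr_natl.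
  by rewrite ler_pdivlMr//; apply: ltW; exact: truncnS_gt.
by apply: lee_sum => i _; apply: ltW; have [] := fTn i.
Qed.

(** For each [k], the centres of a maximal disjoint family of balls of radius [e k] are countably
    many, and by maximality every point is within 2 [e k] of one of them. Rational radii then leave
    countably many balls to choose from. *)
Lemma countable_compact_cover : locally_compact [set: P] ->
  exists (x_ : nat -> P) (r_ : nat -> R) (K_ : nat -> set P),
  (forall n, [/\ 0 < r_ n, compact (K_ n), closed (K_ n) &
    ball (x_ n) (2 * r_ n) `<=` K_ n]) /\
  forall x, exists n, ball (x_ n) (r_ n) x.
Proof.
move=> lc.
pose e (k : nat) : R := k.+1%:R^-1.
have e0 k : 0 < e k by rewrite invr_gt0.
have /choice[S SP] : forall k : nat, exists S : set P,
    countable S /\ forall y, exists2 s, S s & mdist s y < e k + e k.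
  move=> k.
  have [S [_ tS maxS]] := ex_maximal_disjoint_subcollection
    (fun x : P => ball x (e k)) setT.
  exists S; split; first exact: countable_disjoint_balls tS.
  move=> y; apply: contrapT => nS.
  have far s z : S s -> ball s (e k) z -> ball y (e k) z -> False.
    move=> Ss; rewrite !ballEmdist/= => sz yz; apply: nS; exists s => //.
    by have := metric_triangle s z y; rewrite (metric_sym z y); lra.
  have Sy : ~ S y by move=> Sy; apply: nS; exists y => //; rewrite mdistxx addr_gt0.
  apply: (maxS (S `|` [set y])) => //.
    by split => [s Ss|h]; [left|apply: Sy; apply: h; right].
  move=> i j [Si|->] [Sj|->] // [z [iz jz]].
  - by apply: tS => //; exists z.
  - by have := far _ _ Si iz jz.
  - by have := far _ _ Sj jz iz.
pose Q := [set p : P * rat | [/\ (\bigcup_k S k) p.1, 0 < ratr p.2 :> R &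
  exists2 K, compact K /\ closed K & ball p.1 (2 * ratr p.2 : R) `<=` K]].
have cQ : countable Q.
  apply: (@sub_countable _ _ _ ((\bigcup_k S k) `*` setT)).
    by apply: subset_card_le => p [].
  apply: countableX => //; apply: bigcup_countable => // k _; exact: (SP k).1.
have covQ x : exists2 p, Q p & ball p.1 (ratr p.2 : R) x.
  have [K] : exists2 K, nbhs x K & compact K /\ closed K.
    have [K /= Kx cK] := lc x Logic.I.
    exists K => //; move: Kx; rewrite /within/=.
    by apply: filterS => z; apply.
  move=> /nbhs_ballP[r /= r0 rK] cK.
  have r10 : 0 < r / 10 by rewrite divr_gt0.
  have [k _ kP] := near_infty_natSinv_lt (PosNum r10).
  have ek : e k < r / 10 by apply: (kP k) => /=.
  have [s Ss sx] := (SP k).2 x.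
  (* The centre [s] is within r / 5 of [x]. A radius above r / 5 thus captures [x], and one below r
     / 4 keeps the doubled ball within r / 5 + r / 2 < r of [x]. *)
  have [q] : exists q : rat, ratr q \in `](r / 5), (r / 4)[.
    by apply: rat_in_itvoo; lra.
  rewrite in_itv/= => /andP[q1 q2].
  exists (s, q); last by rewrite ballEmdist/=; lra.
  split => /=; [by exists k|lra|exists K => //].
  move=> z; rewrite ballEmdist/= => sz; apply: rK; rewrite ballEmdist/=.
  by have := metric_triangle x s z; rewrite (metric_sym x s); lra.
have [f fP] := countable_enum cQ.
have [p0 Qp0 _] := covQ point.
have /choice[g gP] : forall n : nat, exists p, Q p /\ (Q (f n) -> p = f n).
  by move=> n; have [Qf|Qf] := pselect (Q (f n)); [exists (f n)|exists p0].
have /choice[K KP] : forall n : nat, exists K : set P,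
    [/\ compact K, closed K & ball (g n).1 (2 * ratr (g n).2 : R) `<=` K].
  by move=> n; have [[_ _ [K [? ?] ?]] _] := gP n; exists K.
exists (fun n => (g n).1), (fun n => ratr (g n).2), K; split.
  by move=> n; have [[_ ? _] _] := gP n; have [? ? ?] := KP n.
move=> x; have [p Qp px] := covQ x; have [n fn] := fP p Qp.
by exists n; rewrite (gP n).2 fn.
Qed.

End CountableCover.

(** * Quasicontinuity *)

Section Quasicontinuity.
Context {R : realType} {d : measure_display} {P : metricMeasurableType d R}.
Variables (mu : {measure set P -> \bar R}) (c : R) (N : (P -> \bar R) -> \bar R).
Hypotheses (hP : metric_measure_space mu)
  (hX : quasi_banach_function_lattice mu c N).
Implicit Types (u g : P -> \bar R) (f : P -> R).
Local Open Scope ereal_scope.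

Let c1 : (1 <= c)%R := qbfl_modulus_ge1 hX.
Let c0 : (0 < c)%R := lt_le_trans ltr01 c1.

(** [u] cancels in (u - f2) - (u - f1). Where it is infinite at an end point, the convention on oo -
    oo makes the sum of the two path integrals infinite. *)
Lemma upper_gradient_sub u f1 f2 g1 g2 :
  upper_gradient (u \- (EFin \o f1)) g1 -> upper_gradient (u \- (EFin \o f2)) g2 ->
  upper_gradient (EFin \o (fun x => f1 x - f2 x)%R) (g1 \+ g2).
Proof.
move=> [bg1 g10 ug1] [bg2 g20 ug2]; split.
- exact: emeasurable_funD.
- by move=> x; exact: adde_ge0.
- move=> l gamma cg; rewrite ge0_integralD//; try exact: measurable_curve.
  apply: le_trans (leeD (ug1 _ _ cg) (ug2 _ _ cg)) => /=.
  case: (u (gamma 0%R)) (u (gamma l)) => [x| |] [y| |] //=; rewrite ?leey//.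
  rewrite -EFinD lee_fin.
  set a1 := f1 _; set a2 := f2 _; set b1 := f1 _; set b2 := f2 _.
  apply: le_trans (ler_normB _ _); rewrite -normrN.
  by rewrite le_eqVlt; apply/orP; left; apply/eqP; congr (`|_|%R); ring.
Qed.

(** Absolute values are added instead of differences, because [u] cannot be cancelled where it is
    infinite. *)
Lemma norm_sub_le u f1 f2 (a b : R) : measurable_fun setT u ->
  measurable_fun setT (EFin \o f1) -> measurable_fun setT (EFin \o f2) ->
  N (u \- (EFin \o f1)) <= a%:E -> N (u \- (EFin \o f2)) <= b%:E ->
  N (EFin \o (fun x => f1 x - f2 x)%R) <= (c * (a + b))%:E.
Proof.
move=> mu_ mf1 mf2 Na Nb.
have abs_le w (e : R) : measurable_fun setT w -> N w <= e%:E ->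
    N (fun x => `|w x|) <= e%:E.
  move=> mw; apply: le_trans; apply: (norm_le hX) => //.
    exact: measurableT_comp.
  by move=> x; rewrite abse_id.
have m1 : measurable_fun setT (u \- (EFin \o f1)) by exact: emeasurable_funB.
have m2 : measurable_fun setT (u \- (EFin \o f2)) by exact: emeasurable_funB.
apply: le_trans (norm_add_le hX _ _ (abs_le _ _ m1 Na) (abs_le _ _ m2 Nb)).
- apply: (norm_le hX).
  + exact: (emeasurable_funB mf1 mf2).
  + by apply: emeasurable_funD; exact: measurableT_comp.
  + move=> x /=; rewrite [leRHS]gee0_abs ?adde_ge0//.
    case: (u x) => [r| |] //=; rewrite ?leey// -EFinD lee_fin distrC.
    apply: le_trans (ler_normB _ _); rewrite le_eqVlt; apply/orP; left.
    by apply/eqP; congr (`|_|%R); ring.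
- exact: measurableT_comp.
- exact: measurableT_comp.
Qed.

(** The factor lost in [cap_le_open_superset] depends on the radius of the ball. Since [Z] admits
    test functions of arbitrarily small norm, the bound [e] on each piece can compensate for it. *)
Lemma cap_le_null_open_superset (Z : set P) (b : R) : has_lsc_majorants c N ->
  locally_compact [set: P] -> (forall e, (0 < e)%R -> cap_le N Z e) -> (0 < b)%R ->
  exists V, [/\ open V, Z `<=` V & cap_le N V b].
Proof.
move=> maj lc Z0 b0.
have [x_ [r_ [K_ [xrK cov]]]] := countable_compact_cover hP lc.
have ck n : (0 < b / (2 * c) ^+ n.+1)%R.
  by rewrite divr_gt0// exprn_gt0// mulr_gt0.
have Mn n : (0 < 8 * c ^+ 2 * (1 + (r_ n)^-1))%R.
  have [r0 _ _ _] := xrK n; rewrite mulr_gt0// ?mulr_gt0// ?exprn_gt0//.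
  by rewrite addr_gt0// invr_gt0.
have /choice[U UP] : forall n : nat, exists U, [/\ open U,
    Z `&` ball (x_ n) (r_ n) `<=` U & cap_le N U (b / (2 * c) ^+ n.+1)].
  move=> n; have [r0 cK clK BK] := xrK n.
  pose e := (b / (2 * c) ^+ n.+1 / (8 * c ^+ 2 * (1 + (r_ n)^-1)))%R.
  have e0 : (0 < e)%R by exact: divr_gt0.
  have [U [oU ZU capU]] := cap_le_open_superset hP hX maj cK clK BK r0 e0 (Z0 _ e0).
  by exists U; split => //; rewrite mulrC divfK ?gt_eqF in capU.
exists (\bigcup_n U n); split.
- by apply: bigcup_open => n _; have [] := UP n.
- move=> x Zx; have [n xn] := cov x; exists n => //.
  by have [_ + _] := UP n; apply.
- apply: (cap_le_bigcup hP hX); first exact: ltW.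
  by move=> n; have [] := UP n.
Qed.

Lemma quasi_continuous_of_dense : has_lsc_majorants c N ->
  locally_compact [set: P] -> continuous_dense_N1X N ->
  forall u, in_N1X N u -> quasi_continuous N u.
Proof.
move=> maj lc dense u uN eps eps0; have [mu_ _] := uN.
(* [cap_le_capacity] doubles the bound [dl], and eps / 2 is still strictly below [eps]. *)
pose dl := (eps / 4)%R.
have dl0 : (0 < dl)%R by rewrite divr_gt0.
pose q k : R := ((2 ^+ k)^-1)%R.
have q0 k : (0 < q k)%R by rewrite invr_gt0 exprn_gt0.
have qS k : (q k.+1 = q k / 2)%R by rewrite /q exprS invfM mulrC.
have tc0 : (0 < 2 * c)%R by rewrite mulr_gt0.
have tc2 : (2 <= 2 * c)%R by have := c1; lra.
have tc1 : (1 <= 2 * c)%R by lra.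
pose s k : R := (dl / (2 * c) ^+ k)%R.
have s0 k : (0 < s k)%R by rewrite divr_gt0// exprn_gt0.
have sS k : (s k.+1 * (2 * c) = s k)%R.
  by rewrite /s exprS invfM; field; rewrite !gt_eqF ?exprn_gt0.
have sle k : (s k.+1 <= s k)%R by rewrite -[leRHS]sS ler_peMr// ltW.
(* The weak type estimate divides by the level [q k], leaving [s k.+3]. Comparing two consecutive
   errors costs another factor 2 c, leaving [s k.+2] for [B k], which has index k + 1 in the union
   [E]; index 0 is reserved for the neighbourhood [V] of [Z]. *)
pose eta k : R := (q k * s k.+3)%R.
have eta0 k : (0 < eta k)%R by rewrite mulr_gt0.
have etaS k : (eta k.+1 <= eta k)%R.
  by rewrite /eta qS ler_pM// ?ltW// ?divr_gt0//; have := q0 k; lra.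
have /choice[f fP] : forall k : nat, exists f : P -> R, [/\ continuous f,
    in_N1X N (EFin \o f) & N1norm N (u \- (EFin \o f)) < (eta k)%:E].
  by move=> k; exact: dense.
have mf k : measurable_fun setT (EFin \o f k) by have [_ []] := fP k.
have mw k : measurable_fun setT (u \- (EFin \o f k)) by exact: emeasurable_funB.
have /choice[g gP] : forall k : nat, exists g, [/\ upper_gradient (u \- (EFin \o f k)) g,
    N (u \- (EFin \o f k)) <= (eta k)%:E & N g <= (eta k)%:E].
  by move=> k; apply: (N1norm_lt hP hX) => //; have [] := fP k.
pose A k := [set x | (q k)%:E <= `|u x - (f k x)%:E|].
have capA k : cap_le N (A k) (s k.+3).
  have [ug Nw Ng] := gP k.
  exact: (cap_le_weak hP hX (mw k) ug (q0 k)).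
(* The sets [A k] involve [u] and need not be open, so they do not enter [E] themselves; only their
   upper limit does, through an open superset. The sets [B k] compare continuous functions and are
   open. *)
pose Z := [set x | forall m, exists2 k, (m <= k)%N & A k x].
have capZ b : (0 < b)%R -> cap_le N Z b.
  move=> b0.
  have [m mb] : exists m, (s m <= b)%R.
    have [m _ mP] := near_infty_natSinv_expn_lt (PosNum (divr_gt0 b0 dl0)).
    exists m; rewrite /s mulrC -ler_pdivlMr//; apply: le_trans (ltW (mP m _)) => //=.
    by rewrite div1r lef_pV2 ?posrE ?exprn_gt0// lerXn2r ?nnegrE//; lra.
  apply: (@cap_leS _ _ _ N Z Z _ _ _ mb) => //.
  apply: (@cap_leS _ _ _ N _ (\bigcup_k A (k + m)%N) _ _ _ (lexx _)).
    by move=> x /(_ m)[k mk Ax]; exists (k - m)%N => //; rewrite subnK.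
  apply: (cap_le_bigcup hP hX) => [|k]; first exact: ltW.
  apply: (@cap_leS _ _ _ N _ (A (k + m)%N) _ _ _ _ (capA _)) => //.
  rewrite (_ : s m / _ = s (k + m).+1)%R; last first.
    by rewrite /s -mulrA -invfM -exprD addnC addSn.
  exact: le_trans (sle _) (sle _).
have [V [oV ZV capV]] := cap_le_null_open_superset maj lc capZ (s0 1%N).
pose B k := [set x | (q k < `|f k x - f k.+1 x|)%R].
have oB k : open (B k).
  have cf : continuous (fun x => `|f k x - f k.+1 x|%R).
    move=> x; apply: cvg_norm; apply: cvgB.
      by have [+ _ _] := fP k; exact.
    by have [+ _ _] := fP k.+1; exact.
  rewrite (_ : B k = (fun x => `|f k x - f k.+1 x|%R) @^-1` [set y | (q k < y)%R])//.
  by apply: open_comp => [x _|]; [exact: cf|exact: open_gt].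
have capB k : cap_le N (B k) (s k.+2).
  have [ug1 Nw1 Ng1] := gP k; have [ug2 Nw2 Ng2] := gP k.+1.
  have le2 : (c * (eta k + eta k.+1) <= q k * s k.+2)%R.
    rewrite -sS mulrA -/(eta k) mulrCA [leRHS]mulrA mulrC -mulrA.
    have := etaS k; move: (eta k) (eta k.+1) => a b ab.
    by rewrite [leRHS]mulrA ler_wpM2r ?(ltW c0)//; lra.
  have mdf : measurable_fun setT (EFin \o (fun x => f k x - f k.+1 x)%R).
    exact: (emeasurable_funB (mf k) (mf k.+1)).
  apply: (@cap_leS _ _ _ N _ [set x | (q k)%:E <= `|(f k x - f k.+1 x)%:E|] _ _ _ (lexx _)).
    by move=> x /= /ltW; rewrite lee_fin.
  apply: (cap_le_weak hP hX mdf (upper_gradient_sub ug1 ug2) (q0 k)).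
  - by apply: le_trans (norm_sub_le _ _ _ Nw1 Nw2) _ => //; rewrite lee_fin.
  - apply: (@le_trans _ _ (c * (eta k + eta k.+1))%:E); last by rewrite lee_fin.
    apply: (norm_add_le hX) => //.
      exact: (upper_gradient_measurable hP ug1).
    exact: (upper_gradient_measurable hP ug2).
pose G n := if n is k.+1 then B k else V.
pose E := \bigcup_n G n.
have capE : cap_le N E dl.
  by apply: (cap_le_bigcup hP hX) => [|[|k]]; [exact: ltW|exact: capV|exact: capB].
have close x k : ~ E x -> u x \is a fin_num /\ (`|fine (u x) - f k x| <= 2 * q k)%R.
  move=> Ex.
  have step j : (`|f j x - f j.+1 x| <= q j)%R.
    by rewrite leNgt; apply/negP => Bx; apply: Ex; exists j.+1.
  have [m mA] : exists m, forall j, (m <= j)%N -> ~ A j x.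
    apply: contrapT => nm; apply: Ex; exists 0%N => //; apply: ZV => m.
    apply: contrapT => nk; apply: nm; exists m => j mj Aj; apply: nk.
    by exists j.
  have uA j : (m <= j)%N -> `|u x - (f j x)%:E| < (q j)%:E.
    by move=> mj; rewrite ltNge; apply/negP; exact: mA.
  have ufin : u x \is a fin_num by case: (u x) (uA m (leqnn m)).
  split => //.
  (* The right side is the exact sum of [q i] for k <= i < k + j. The subtracted 2 q (k + j) leaves
     room for the error q (k + j) between [u] and [f (k + j)]. *)
  have tele j : (`|f k x - f (k + j)%N x| <= 2 * q k - 2 * q (k + j)%N)%R.
    elim: j => [|j ih]; first by rewrite addn0 !subrr normr0.
    rewrite addnS qS; have := step (k + j)%N.
    have := ler_distD (f (k + j)%N x) (f k x) (f (k + j).+1 x); lra.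
  have := tele m; have := uA (k + m)%N (leq_addl _ _).
  rewrite -(fineK ufin) -EFinD lte_fin.
  have := q0 (k + m)%N.
  have := ler_distD (f (k + m)%N x) (fine (u x)) (f k x).
  by rewrite (distrC (f (k + m)%N x) (f k x)) /=; lra.
exists E; split.
- by apply: bigcup_open => -[|k] _; [exact: oV|exact: oB].
- by apply: le_lt_trans (cap_le_capacity capE) _; rewrite lte_fin /dl; lra.
- apply/subspace_continuousP => x Ex.
  have [ufin _] := close x 0%N Ex.
  suff : u y @[y --> within (~` E) (nbhs x)] --> u x by [].
  rewrite -(fineK ufin); apply/fine_cvgP; split.
    by apply: filterS (withinT _ _) => y Ey; have [] := close y 0%N Ey.
  apply/cvgrPdist_lt => e e0.
  (* Replacing [u] by [f k] at the two points costs 4 q k < e / 2; continuity of [f k] accounts for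
     the other half. *)
  have e80 : (0 < e / 8)%R by rewrite divr_gt0.
  have [k _ kP] := near_infty_natSinv_expn_lt (PosNum e80).
  have qk : (q k < e / 8)%R by have := kP k (leqnn k); rewrite /= div1r.
  have [cf _ _] := fP k.
  have fk : \forall y \near within (~` E) (nbhs x), (`|f k x - f k y| < e / 2)%R.
    apply: cvg_within; move: (cf x) => /cvgrPdist_lt; apply.
    by rewrite divr_gt0.
  near=> y.
  have Ey : ~ E y by near: y; exact: withinT.
  have [_ h1] := close x k Ex; have [_ h2] := close y k Ey.
  have h3 : (`|f k x - f k y| < e / 2)%R by near: y.
  have := ler_distD (f k x) (fine (u x)) (fine (u y)).
  have := ler_distD (f k y) (f k x) (fine (u y)).
  by rewrite (distrC (f k y) (fine (u y))) /=; lra.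
- by move=> x Ex; have [] := close x 0%N Ex.
Unshelve. all: end_near. Qed.

End Quasicontinuity.

Theorem corollary4p6 (R : realType) (d : measure_display)
    (P : metricMeasurableType d R) (mu : {measure set P -> \bar R})
    (hP : metric_measure_space mu)
    (hlc : locally_compact [set: P])
    (c : R) (N : (P -> \bar R) -> \bar R)
    (hX : quasi_banach_function_lattice mu c N)
    (hVC : vitali_caratheodory N \/ bounded_sets_absolutely_continuous N mu)
    (hdense : continuous_dense_N1X N) :
  forall u : P -> \bar R, in_N1X N u -> quasi_continuous N u.
Proof.
have maj : has_lsc_majorants c N.
  case: hVC => [vc|bac]; first exact: vitali_caratheodory_majorants hX vc.
  exact: bounded_absolutely_continuous_majorants hP hX bac.
exact: quasi_continuous_of_dense hP hX maj hlc hdense.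
Qed.
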